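(* Let $X$ be a finite mc-biquandle, let $S\subset\mathrm{End}(X)$ be a set of endomorphisms of $X$, and let $L$ be an oriented classical or virtual knot or link diagram. Then the directed graph isomorphism type of the mc-biquandle coloring quiver $\mathcal{Q}_X^S(L)$ is an invariant of $L$. That is, if two diagrams represent the same oriented classical or virtual knot or link, then their mc-biquandle coloring quivers with respect to $X$ and $S$ are isomorphic as directed graphs.
   Context: **mc-biquandles.** An mc-biquandle is a set $X$ with two pairs of binary operations $\underline{\triangleright}^s,\overline{\triangleright}^s$ and $\underline{\triangleright}^m,\overline{\triangleright}^m$ such that: (i) for all $x\in X$, $x\,\overline{\triangleright}^s x=x\,\underline{\triangleright}^s x$; (ii) for all $y\in X$ and $j\in\{s,m\}$, the maps $\alpha^j_y,\beta^j_y:X\to X$, $\alpha^j_y(x)=x\,\underline{\triangleright}^j y$, $\beta^j_y(x)=x\,\overline{\triangleright}^j y$, are invertible, and the map $S^j:X\times X\to X\times X$, $S^j(x,y)=(y\,\overline{\triangleright}^j x,\;x\,\underline{\triangleright}^j y)$, is invertible; (iii) for all $x,y,z\in X$ and all $(j,k,l)\in\{(s,s,s),(s,m,m),(m,s,m),(m,m,s),(m,m,m)\}$: $$(x\,\overline{\triangleright}^k y)\,\overline{\triangleright}^l (z\,\overline{\triangleright}^j y)=(x\,\overline{\triangleright}^l z)\,\overline{\triangleright}^k (y\,\underline{\triangleright}^j z),$$ $$(x\,\underline{\triangleright}^l y)\,\overline{\triangleright}^j (z\,\underline{\triangleright}^k y)=(x\,\overline{\triangleright}^j z)\,\underline{\triangleright}^l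 (y\,\overline{\triangleright}^k z),$$ $$(x\,\underline{\triangleright}^k y)\,\underline{\triangleright}^j (z\,\underline{\triangleright}^l y)=(x\,\underline{\triangleright}^j z)\,\underline{\triangleright}^k (y\,\overline{\triangleright}^l z).$$ A homomorphism of mc-biquandles is a map preserving all four operations; $\mathrm{Hom}(Y,X)$ is the set of homomorphisms $Y\to X$, and $\mathrm{End}(X)=\mathrm{Hom}(X,X)$. **Diagrams.** Two diagrams of oriented classical links represent the same link iff they are related by planar isotopy and oriented Reidemeister moves I, II, III; for virtual link diagrams one also allows the virtual moves (detour moves). A classical (non-virtual) crossing is single-component (type $s$) if both its strands belong to the same component of the link, and multi-component (type $m$) if they belong to different components. Semiarcs are the pieces obtained by cutting the diagram at all classical crossing points, on both the over- and the understrand (virtual crossings do not cut; a component with no classical crossing contributes one semiarc). **Crossing relations.** At a classical crossing of type $l\in\{s,m\}$, let $x$ be the semiarc of the understrand lying to the right of the oriented overstrand, $y$ the semiarc of the overstrand lying to the right of the oriented understrand, $x'$ the other understrand semiarc and $y'$ the other overstrand semiarc. The crossing relations are $x'=x\,\underline{\triangleright}^l y$ and $y'=y\,\overline{\triangleright}^l x$. (For a positive crossing $x$ is the incoming under-semiarc and $y$ the outgoing over-semiarc; for a negative crossing $x$ is the outgoing under-semiarc and $y$ the incoming over-semiarc.) Nothing is imposed at virtual crossings. **Fundamental mc-biquandle.** For a diagram $D$, $\mathcal{MCB}(D)$ is defined as follows. Take one generator for each semiarc of $D$. An mc-biquandle word is a generator or an expression of one of the forms $w\,\underline{\triangleright}^l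 w'$, $w\,\overline{\triangleright}^l w'$, $(\alpha^l_{w})^{-1}(w')$, $(\beta^l_{w})^{-1}(w')$, $(S^l)^{-1}_i(w,w')$, where $l\in\{s,m\}$, $i\in\{1,2\}$, $w,w'$ are mc-biquandle words, and $(S^l)^{-1}_i$ denotes the $i$-th component of $(S^l)^{-1}$. The elements of $\mathcal{MCB}(D)$ are the equivalence classes of mc-biquandle words under the congruence generated by the mc-biquandle axioms and the crossing relations at all classical crossings of $D$. Elements of $\mathrm{Hom}(\mathcal{MCB}(D),X)$ correspond to $X$-colorings of $D$, i.e. assignments of elements of $X$ to the semiarcs satisfying all crossing relations. **Coloring quiver.** For a diagram $D$ and $S\subset\mathrm{End}(X)$, the mc-biquandle coloring quiver $\mathcal{Q}_X^S(D)$ is the directed graph (loops and parallel edges allowed) with one vertex for each $f\in\mathrm{Hom}(\mathcal{MCB}(D),X)$ and, for each vertex $f$ and each $\phi\in S$, one edge from $f$ to the vertex obtained by applying $f$ first and then $\phi$, i.e. $\phi\circ f$. *)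

(* Defs.v *)
From HB Require Import structures.
From mathcomp Require Import all_boot all_order all_algebra all_fingroup.
From mathcomp Require Import generic_quotient.
From mathcomp Require Import all_classical all_reals all_analysis.
From Stdlib Require Relation_Operators.
Set Implicit Arguments.
Unset Strict Implicit.
Unset Printing Implicit Defensive.
Import Order.TTheory GRing.Theory Num.Theory.
Import numFieldNormedType.Exports.
Local Open Scope classical_set_scope.
Local Open Scope ring_scope.

Variant ctype := single | multi.

Variant mc_triple : ctype -> ctype -> ctype -> Prop :=
  | Tsss : mc_triple single single single
  | Tsmm : mc_triple single multi multi
  | Tmsm : mc_triple multi single multi
  | Tmms : mc_triple multi multi single
  | Tmmm : mc_triple multi multi multi.

(* [utri l x y] and [otri l x y] are x |> y of type l with the triangle
   underlined, resp. overlined. *)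
HB.mixin Record isMCBiquandle (X : Type) := {
  utri : ctype -> X -> X -> X;
  otri : ctype -> X -> X -> X;
  over_diag : forall x, otri single x x = utri single x x;
  under_bij : forall l y, bijective (fun x => utri l x y);
  over_bij : forall l y, bijective (fun x => otri l x y);
  switch_bij : forall l,
    bijective (fun p : X * X => (otri l p.2 p.1, utri l p.1 p.2));
  exchange_oo : forall j k l, mc_triple j k l -> forall x y z,
    otri l (otri k x y) (otri j z y) = otri k (otri l x z) (utri j y z);
  exchange_uo : forall j k l, mc_triple j k l -> forall x y z,
    otri j (utri l x y) (utri k z y) = utri l (otri j x z) (otri k y z);
  exchange_uu : forall j k l, mc_triple j k l -> forall x y z,
    utri j (utri k x y) (utri l z y) = utri k (utri j x z) (otri l y z)
}.

#[short(type="mcBiquandleType")]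
HB.structure Definition MCBiquandle := {X of isMCBiquandle X}.

Record mcHom (Y X : mcBiquandleType) := McHom {
  mcHom_fun :> Y -> X;
  mcHom_under : forall l x y,
    mcHom_fun (utri l x y) = utri l (mcHom_fun x) (mcHom_fun y);
  mcHom_over : forall l x y,
    mcHom_fun (otri l x y) = otri l (mcHom_fun x) (mcHom_fun y)
}.

Definition mcEnd (X : mcBiquandleType) := mcHom X X.

Section Composition.
Variables (Z Y X : mcBiquandleType) (phi : mcHom Y X) (f : mcHom Z Y).

Fact mcComp_under l x y :
  phi (f (utri l x y)) = utri l (phi (f x)) (phi (f y)).
Proof. by rewrite !mcHom_under. Qed.

Fact mcComp_over l x y :
  phi (f (otri l x y)) = otri l (phi (f x)) (phi (f y)).
Proof. by rewrite !mcHom_over. Qed.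

Definition mcComp : mcHom Z X :=
  @McHom Z X (fun x => phi (f x)) mcComp_under mcComp_over.
End Composition.

Inductive mcWord (G : Type) : Type :=
  | WGen of G
  | WUnder of ctype & mcWord G & mcWord G
  | WOver of ctype & mcWord G & mcWord G
  (* [WAlphaInv l y x] is the inverse of [utri l ^~ y] applied to x;
     likewise [WBetaInv l y x] for [otri l ^~ y]. *)
  | WAlphaInv of ctype & mcWord G & mcWord G
  | WBetaInv of ctype & mcWord G & mcWord G
  | WSInv1 of ctype & mcWord G & mcWord G
  | WSInv2 of ctype & mcWord G & mcWord G.

HB.instance Definition _ (G : Type) := gen_eqMixin (mcWord G).
HB.instance Definition _ (G : Type) := gen_choiceMixin (mcWord G).

Inductive mcCong (G : Type) (rel : mcWord G -> mcWord G -> Prop) :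
    mcWord G -> mcWord G -> Prop :=
  | CRel w w' : rel w w' -> mcCong rel w w'
  | CRefl w : mcCong rel w w
  | CSym w w' : mcCong rel w w' -> mcCong rel w' w
  | CTrans w1 w2 w3 : mcCong rel w1 w2 -> mcCong rel w2 w3 -> mcCong rel w1 w3
  | CUnder l x x' y y' : mcCong rel x x' -> mcCong rel y y' ->
      mcCong rel (WUnder l x y) (WUnder l x' y')
  | COver l x x' y y' : mcCong rel x x' -> mcCong rel y y' ->
      mcCong rel (WOver l x y) (WOver l x' y')
  | CAlphaInv l x x' y y' : mcCong rel x x' -> mcCong rel y y' ->
      mcCong rel (WAlphaInv l x y) (WAlphaInv l x' y')
  | CBetaInv l x x' y y' : mcCong rel x x' -> mcCong rel y y' ->
      mcCong rel (WBetaInv l x y) (WBetaInv l x' y')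
  | CSInv1 l x x' y y' : mcCong rel x x' -> mcCong rel y y' ->
      mcCong rel (WSInv1 l x y) (WSInv1 l x' y')
  | CSInv2 l x x' y y' : mcCong rel x x' -> mcCong rel y y' ->
      mcCong rel (WSInv2 l x y) (WSInv2 l x' y')
  | CDiag x : mcCong rel (WOver single x x) (WUnder single x x)
  | CAlphaK l x y : mcCong rel (WAlphaInv l y (WUnder l x y)) x
  | CAlphaVK l x y : mcCong rel (WUnder l (WAlphaInv l y x) y) x
  | CBetaK l x y : mcCong rel (WBetaInv l y (WOver l x y)) x
  | CBetaVK l x y : mcCong rel (WOver l (WBetaInv l y x) y) x
  | CSK1 l x y : mcCong rel (WSInv1 l (WOver l y x) (WUnder l x y)) x
  | CSK2 l x y : mcCong rel (WSInv2 l (WOver l y x) (WUnder l x y)) y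
  | CSVK1 l u v : mcCong rel (WOver l (WSInv2 l u v) (WSInv1 l u v)) u
  | CSVK2 l u v : mcCong rel (WUnder l (WSInv1 l u v) (WSInv2 l u v)) v
  | CExchange_oo j k l : mc_triple j k l -> forall x y z,
      mcCong rel (WOver l (WOver k x y) (WOver j z y))
                 (WOver k (WOver l x z) (WUnder j y z))
  | CExchange_uo j k l : mc_triple j k l -> forall x y z,
      mcCong rel (WOver j (WUnder l x y) (WUnder k z y))
                 (WUnder l (WOver j x z) (WOver k y z))
  | CExchange_uu j k l : mc_triple j k l -> forall x y z,
      mcCong rel (WUnder j (WUnder k x y) (WUnder l z y))
                 (WUnder k (WUnder j x z) (WOver l y z)).

Section Presentation.
Variables (G : Type) (rels : mcWord G -> mcWord G -> Prop).

Definition mcCongb : rel (mcWord G) := fun w w' => `[< mcCong rels w w' >].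

Fact mcCongb_refl : reflexive mcCongb.
Proof. by move=> w; apply/asboolP; exact: CRefl. Qed.

Fact mcCongb_sym : symmetric mcCongb.
Proof. by move=> w w'; apply/asboolP/asboolP => /CSym. Qed.

Fact mcCongb_trans : transitive mcCongb.
Proof.
by move=> w2 w1 w3 /asboolP h /asboolP h'; apply/asboolP; exact: CTrans h h'.
Qed.

Canonical mcCongb_equiv :=
  EquivRel mcCongb mcCongb_refl mcCongb_sym mcCongb_trans.

Definition presented : Type := {eq_quot mcCongb_equiv}%qT.

Definition pclass (w : mcWord G) : presented :=
  (\pi_({eq_quot mcCongb_equiv}) w)%qT.
Definition prepr (x : presented) : mcWord G :=
  repr (x : {eq_quot mcCongb_equiv}%qT).

Fact pclassP w w' : mcCong rels w w' <-> pclass w = pclass w'.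
Proof.
split=> [h|h]; first by apply/eqmodP/asboolP.
by apply/asboolP; move/eqmodP: h.
Qed.

Fact preprK x : pclass (prepr x) = x.
Proof. exact: reprK. Qed.

Fact preprP w : mcCong rels (prepr (pclass w)) w.
Proof. by apply/pclassP; rewrite preprK. Qed.

Definition p_under l (x y : presented) := pclass (WUnder l (prepr x) (prepr y)).
Definition p_over l (x y : presented) := pclass (WOver l (prepr x) (prepr y)).

Fact p_underE l w w' :
  p_under l (pclass w) (pclass w') = pclass (WUnder l w w').
Proof. by apply/pclassP; apply: CUnder; exact: preprP. Qed.

Fact p_overE l w w' : p_over l (pclass w) (pclass w') = pclass (WOver l w w').
Proof. by apply/pclassP; apply: COver; exact: preprP. Qed.

Fact p_over_diag x : p_over single x x = p_under single x x.
Proof. by apply/pclassP; exact: CDiag. Qed.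

Fact p_under_bij l y : bijective (fun x => p_under l x y).
Proof.
exists (fun x => pclass (WAlphaInv l (prepr y) (prepr x))) => x.
  rewrite -[RHS]preprK; apply/pclassP; apply: CTrans (CAlphaK _ l _ (prepr y)).
  by apply: CAlphaInv; [exact: CRefl|exact: preprP].
rewrite -[RHS]preprK; apply/pclassP; apply: CTrans (CAlphaVK _ l _ (prepr y)).
by apply: CUnder; [exact: preprP|exact: CRefl].
Qed.

Fact p_over_bij l y : bijective (fun x => p_over l x y).
Proof.
exists (fun x => pclass (WBetaInv l (prepr y) (prepr x))) => x.
  rewrite -[RHS]preprK; apply/pclassP; apply: CTrans (CBetaK _ l _ (prepr y)).
  by apply: CBetaInv; [exact: CRefl|exact: preprP].
rewrite -[RHS]preprK; apply/pclassP; apply: CTrans (CBetaVK _ l _ (prepr y)).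
by apply: COver; [exact: preprP|exact: CRefl].
Qed.

Fact p_switch_bij l :
  bijective (fun p : presented * presented =>
               (p_over l p.2 p.1, p_under l p.1 p.2)).
Proof.
exists (fun p => (pclass (WSInv1 l (prepr p.1) (prepr p.2)),
                  pclass (WSInv2 l (prepr p.1) (prepr p.2)))) => -[x y] /=.
  congr pair; rewrite -[RHS]preprK; apply/pclassP.
    apply: CTrans (CSK1 _ l _ (prepr y)).
    by apply: CSInv1; exact: preprP.
  apply: CTrans (CSK2 _ l (prepr x) _).
  by apply: CSInv2; exact: preprP.
congr pair; rewrite -[RHS]preprK; apply/pclassP.
  apply: CTrans (CSVK1 _ l _ (prepr y)).
  by apply: COver; exact: preprP.
apply: CTrans (CSVK2 _ l (prepr x) _).
by apply: CUnder; exact: preprP.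
Qed.

Fact p_exchange_oo j k l : mc_triple j k l -> forall x y z,
  p_over l (p_over k x y) (p_over j z y) =
  p_over k (p_over l x z) (p_under j y z).
Proof.
move=> t x y z; rewrite -(preprK x) -(preprK y) -(preprK z).
by rewrite !(p_overE, p_underE); apply/pclassP; exact: CExchange_oo.
Qed.

Fact p_exchange_uo j k l : mc_triple j k l -> forall x y z,
  p_over j (p_under l x y) (p_under k z y) =
  p_under l (p_over j x z) (p_over k y z).
Proof.
move=> t x y z; rewrite -(preprK x) -(preprK y) -(preprK z).
by rewrite !(p_overE, p_underE); apply/pclassP; exact: CExchange_uo.
Qed.

Fact p_exchange_uu j k l : mc_triple j k l -> forall x y z,
  p_under j (p_under k x y) (p_under l z y) =
  p_under k (p_under j x z) (p_over l y z).
Proof.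
move=> t x y z; rewrite -(preprK x) -(preprK y) -(preprK z).
by rewrite !(p_overE, p_underE); apply/pclassP; exact: CExchange_uu.
Qed.

HB.instance Definition _ := isMCBiquandle.Build presented
  p_over_diag p_under_bij p_over_bij p_switch_bij
  p_exchange_oo p_exchange_uo p_exchange_uu.

End Presentation.

Section Diagrams.
Variable R : realType.
Implicit Types (v w : R * R).

Definition det2 v w : R := v.1 * w.2 - v.2 * w.1.

(* A point of the source of the diagram, which is a disjoint union of n
   circles R/Z: (i, t) is the point of parameter t mod 1 on component i. *)
Definition circle_point n : Type := ('I_n * R)%type.

Definition same_point n (p q : circle_point n) : Prop :=
  p.1 = q.1 /\ exists k : int, p.2 = q.2 + k%:~R.

Section Curves.
Variables (n : nat) (curve : 'I_n -> R -> R * R).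

Definition velocity (p : circle_point n) : R * R := derive1 (curve p.1) p.2.

Definition crossing (p q : circle_point n) : Prop :=
  ~ same_point p q /\ curve p.1 p.2 = curve q.1 q.2.
End Curves.

(* C^1-immersed oriented closed curves, with finitely many multiple points,
   all of them transverse double points. [above p q] means that p and q lie
   over a classical crossing, p on the overstrand and q on the understrand;
   a double point with neither [above p q] nor [above q p] is a virtual
   crossing. *)
Record diagram (n : nat) := Diagram {
  curve : 'I_n -> R -> R * R;
  above : circle_point n -> circle_point n -> Prop;
  curve_periodic : forall i t, curve i (t + 1) = curve i t;
  curve_derivable : forall i t, derivable (curve i) t 1;
  curve_C1 : forall i, continuous (derive1 (curve i));
  curve_immersed : forall p, velocity curve p <> 0;
  curve_transverse : forall p q, crossing curve p q ->
    det2 (velocity curve p) (velocity curve q) <> 0;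
  curve_double : forall p q r, crossing curve p q -> crossing curve p r ->
    same_point q r;
  curve_finite :
    finite_set [set p | 0 <= p.2 < 1 /\ exists q, crossing curve p q];
  above_crossing : forall p q, above p q -> crossing curve p q;
  above_asym : forall p q, above p q -> ~ above q p;
  above_same : forall p p' q q', same_point p p' -> same_point q q' ->
    above p q -> above p' q'
}.

Definition link_diagram : Type := {n : nat & diagram n}.

Definition no_virtual n (D : diagram n) : Prop :=
  forall p q, crossing (curve D) p q -> above D p q \/ above D q p.

Section Fundamental.
Variables (n : nat) (D : diagram n).

Definition cut_point (p : circle_point n) : Prop :=
  exists q, above D p q \/ above D q p.

(* p and q are joined by an arc of the circle without cut point, lifted here
   to an interval of R. *)
Definition joined (p q : circle_point n) : Prop :=
  p.1 = q.1 /\ exists k : int, forall u,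
    Num.min p.2 (q.2 + k%:~R) <= u <= Num.max p.2 (q.2 + k%:~R) ->
    ~ cut_point (p.1, u).

Record semiarc := Semiarc {
  semiarc_set :> set (circle_point n);
  semiarcP : exists2 p, ~ cut_point p & semiarc_set = [set q | joined p q]
}.

Definition ends_at (A : semiarc) (p : circle_point n) : Prop :=
  \forall u \near p.2^'-, semiarc_set A (p.1, u).

Definition starts_at (A : semiarc) (p : circle_point n) : Prop :=
  \forall u \near p.2^'+, semiarc_set A (p.1, u).

Definition positive (p q : circle_point n) : Prop :=
  0 < det2 (velocity (curve D) p) (velocity (curve D) q).

(* p is on the overstrand, q on the understrand of a classical crossing.
   x is the semiarc of the understrand to the right of the overstrand,
   y the semiarc of the overstrand to the right of the understrand,
   x' and y' are the other semiarcs of the under- and overstrand.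
   The crossing is positive when the velocities of the over- and understrand
   form a direct basis: the understrand then goes from right to left. *)
Definition crossing_semiarcs (p q : circle_point n)
    (x y x' y' : semiarc) : Prop :=
  above D p q /\
  ((positive p q /\ [/\ ends_at x q, starts_at y p,
                        starts_at x' q & ends_at y' p]) \/
   (~ positive p q /\ [/\ starts_at x q, ends_at y p,
                          ends_at x' q & starts_at y' p])).

Definition crossing_type (p q : circle_point n) : ctype :=
  if p.1 == q.1 then single else multi.

Variant crossing_relation : mcWord semiarc -> mcWord semiarc -> Prop :=
  | UnderRelation p q x y x' y' : crossing_semiarcs p q x y x' y' ->
      crossing_relation (WGen x')
        (WUnder (crossing_type p q) (WGen x) (WGen y))
  | OverRelation p q x y x' y' : crossing_semiarcs p q x y x' y' ->
      crossing_relation (WGen y')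
        (WOver (crossing_type p q) (WGen y) (WGen x)).

Definition MCB : mcBiquandleType := presented crossing_relation.
End Fundamental.

(* A strand (i, (a, b)) is the arc of component i with parameters in [a, b]. *)
Definition strand n : Type := ('I_n * (R * R))%type.

Definition proper_strand n (J : strand n) : Prop := J.2.1 < J.2.2 < J.2.1 + 1.

Definition on_strand n (J : strand n) : set (circle_point n) :=
  [set p | p.1 = J.1 /\ exists k : int, J.2.1 <= p.2 + k%:~R <= J.2.2].

Definition inside_strand n (J : strand n) : set (circle_point n) :=
  [set p | p.1 = J.1 /\ exists k : int, J.2.1 < p.2 + k%:~R < J.2.2].

Definition agree_off n (A : set (circle_point n)) (D D' : diagram n) : Prop :=
  (forall p, ~ A p -> curve D' p.1 p.2 = curve D p.1 p.2) /\
  (forall p q, ~ A p -> ~ A q -> (above D' p q <-> above D p q)).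

(* Same oriented curves and crossings, up to the choice of the parameters and
   of the numbering of the components. *)
Definition reparametrization n (D D' : diagram n) : Prop :=
  exists (s : 'S_n) (phi : 'I_n -> R -> R),
    [/\ forall i t, phi i (t + 1) = phi i t + 1,
        forall i t, derivable (phi i) t 1 /\ 0 < derive1 (phi i) t,
        forall i, continuous (derive1 (phi i)),
        forall i t, curve D' i t = curve D (s i) (phi i t) &
        forall p q, above D' p q <->
          above D (s p.1, phi p.1 p.2) (s q.1, phi q.1 q.2)].

Definition differential (f : R * R -> R * R) v w : R * R := 'd f v w.

Definition jacobian (f : R * R -> R * R) (v : R * R) : R :=
  det2 (differential f v (1, 0)) (differential f v (0, 1)).

Definition ambient_isotopy (H : R -> R * R -> R * R) : Prop :=
  let cylinder : set (R * (R * R)) := [set tv | 0 <= tv.1 <= 1] in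
  [/\ forall v, H 0 v = v,
      forall t, 0 <= t <= 1 -> bijective (H t),
      {within cylinder, continuous (fun tv : R * (R * R) => H tv.1 tv.2)},
      forall t v, 0 <= t <= 1 -> differentiable (H t) v /\ jacobian (H t) v <> 0
    & forall w,
        {within cylinder, continuous
          (fun tv : R * (R * R) => differential (H tv.1) tv.2 w)}].

Definition planar_isotopy n (D D' : diagram n) : Prop :=
  exists2 H, ambient_isotopy H &
    (forall i t, curve D' i t = H 1 (curve D i t)) /\
    (forall p q, above D' p q <-> above D p q).

(* The Reidemeister moves are performed inside this disk; planar isotopies
   bring any other disk there. *)
Definition box : set (R * R) := [set v | `|v.1| <= 1 /\ `|v.2| <= 1].
Definition open_box : set (R * R) := [set v | `|v.1| < 1 /\ `|v.2| < 1].

Definition outside_box n (A : set (circle_point n)) (D : diagram n) : Prop :=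
  forall p, ~ A p -> ~ box (curve D p.1 p.2).

(* A crossingless arc of the disk against an arc with one classical
   self-crossing, of any kind. *)
Definition reidemeister1 n (D D' : diagram n) : Prop :=
  exists J : strand n,
    [/\ proper_strand J, agree_off (inside_strand J) D D',
        outside_box (on_strand J) D,
        (forall p, inside_strand J p ->
           open_box (curve D p.1 p.2) /\ open_box (curve D' p.1 p.2)) &
        (forall p q, on_strand J p -> on_strand J q ->
           ~ crossing (curve D) p q) /\
        exists p0 q0,
          [/\ inside_strand J p0, inside_strand J q0, above D' p0 q0 &
              forall p q, on_strand J p -> on_strand J q ->
                crossing (curve D') p q ->
                (same_point p p0 /\ same_point q q0) \/
                (same_point p q0 /\ same_point q p0)]].

(* The strand runs through the box along the graph of f above [-1, 1], from
   left to right if d = false and from right to left if d = true. *)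
Definition graph_strand n (D : diagram n) (J : strand n) (d : bool)
    (f : R -> R) : Prop :=
  forall t, J.2.1 <= t <= J.2.2 ->
    let x := (-1) ^+ d * (2 * (t - J.2.1) / (J.2.2 - J.2.1) - 1) in
    curve D J.1 t = (x, f x) /\ `|f x| < 1.

Definition strand_above n (D : diagram n) (J K : strand n) : Prop :=
  forall p q, on_strand J p -> on_strand K q -> crossing (curve D) p q ->
    above D p q.

Definition disjoint_strands n (J K : strand n) : Prop :=
  on_strand J `&` on_strand K = set0.

(* The graph of f is below that of g; the move creates a bigon above ]a, b[. *)
Definition reidemeister2 n (D D' : diagram n) : Prop :=
  exists (J K : strand n) (d e : bool) (f g f' g' : R -> R) (a b : R),
    [/\ [/\ proper_strand J, proper_strand K & disjoint_strands J K],
        agree_off (inside_strand J `|` inside_strand K) D D',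
        outside_box (on_strand J `|` on_strand K) D,
        [/\ graph_strand D J d f, graph_strand D K e g &
            forall x, -1 <= x <= 1 -> f x < g x] &
        [/\ graph_strand D' J d f', graph_strand D' K e g',
            [/\ -1 < a, a < b & b < 1],
            forall x, -1 <= x <= 1 ->
              [/\ x < a -> f' x < g' x, a < x < b -> g' x < f' x &
                  b < x -> f' x < g' x] &
            strand_above D' J K \/ strand_above D' K J]].

Definition cross_once (f g : R -> R) (c : R) : Prop :=
  forall x, -1 <= x <= 1 -> (x < c -> f x < g x) /\ (c < x -> g x < f x).

(* Three strands in the braid positions s1 s2 s1 and s2 s1 s2, with arbitrary
   orientations; h k is the height of the strand J k, the same before and after
   the move. *)
Definition reidemeister3 n (D D' : diagram n) : Prop :=
  exists (J : 'I_3 -> strand n) (d : 'I_3 -> bool) (f f' : 'I_3 -> R -> R)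
         (h : 'S_3),
    let i0 : 'I_3 := inord 0 in
    let i1 : 'I_3 := inord 1 in
    let i2 : 'I_3 := inord 2 in
    let strands := \bigcup_k on_strand (J k) in
    [/\ (forall k, proper_strand (J k)) /\
        (forall k l, k <> l -> disjoint_strands (J k) (J l)),
        agree_off (\bigcup_k inside_strand (J k)) D D' /\ outside_box strands D,
        forall k, graph_strand D (J k) (d k) (f k) /\
                  graph_strand D' (J k) (d k) (f' k),
        forall k l, (h k < h l)%N ->
          strand_above D (J l) (J k) /\ strand_above D' (J l) (J k) &
        (exists c01 c02 c12,
          [/\ -1 < c01, c01 < c02, c02 < c12 & c12 < 1] /\
          [/\ cross_once (f i0) (f i1) c01, cross_once (f i0) (f i2) c02 &
              cross_once (f i1) (f i2) c12]) /\
        (exists c01 c02 c12,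
          [/\ -1 < c12, c12 < c02, c02 < c01 & c01 < 1] /\
          [/\ cross_once (f' i0) (f' i1) c01, cross_once (f' i0) (f' i2) c02 &
              cross_once (f' i1) (f' i2) c12])].

(* An arc meeting the rest of the diagram and itself only in virtual crossings
   is replaced by any other such arc with the same ends. *)
Definition detour n (D D' : diagram n) : Prop :=
  exists J : strand n,
    [/\ proper_strand J, agree_off (inside_strand J) D D' &
        forall p, on_strand J p -> ~ cut_point D p /\ ~ cut_point D' p].

Variant classical_move n (D D' : diagram n) : Prop :=
  | MReparametrization of reparametrization D D'
  | MIsotopy of planar_isotopy D D'
  | MR1 of reidemeister1 D D'
  | MR2 of reidemeister2 D D'
  | MR3 of reidemeister3 D D'.

(* The number of components is unchanged by every move. *)
Variant classical_step : link_diagram -> link_diagram -> Prop :=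
  ClassicalStep n (D D' : diagram n) of no_virtual D & no_virtual D' &
    classical_move D D' : classical_step (existT _ n D) (existT _ n D').

Variant virtual_step : link_diagram -> link_diagram -> Prop :=
  | VirtualClassical n (D D' : diagram n) of classical_move D D' :
      virtual_step (existT _ n D) (existT _ n D')
  | VirtualDetour n (D D' : diagram n) of detour D D' :
      virtual_step (existT _ n D) (existT _ n D').

Definition same_classical_link (L L' : link_diagram) : Prop :=
  [/\ no_virtual (projT2 L), no_virtual (projT2 L') &
      Relation_Operators.clos_refl_sym_trans _ classical_step L L'].

Definition same_virtual_link (L L' : link_diagram) : Prop :=
  Relation_Operators.clos_refl_sym_trans _ virtual_step L L'.

Definition same_link (L L' : link_diagram) : Prop :=
  same_classical_link L L' \/ same_virtual_link L L'.

End Diagrams.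

Record quiver := Quiver {
  vertex : Type;
  edge : Type;
  source : edge -> vertex;
  target : edge -> vertex
}.

Definition quiver_iso (Q Q' : quiver) : Prop :=
  exists (fv : vertex Q -> vertex Q') (fe : edge Q -> edge Q'),
    [/\ bijective fv, bijective fe,
        forall e, source (fe e) = fv (source e) &
        forall e, target (fe e) = fv (target e)].

Definition coloring_quiver (R : realType) (X : mcBiquandleType)
    (S : set (mcEnd X)) (L : link_diagram R) : quiver :=
  let M := MCB (projT2 L) in
  @Quiver (mcHom M X) (mcHom M X * {phi : mcEnd X | S phi})
    (fun e => e.1) (fun e => mcComp (sval e.2) e.1).

(* Main.v *)
(* Homomorphisms from MCB(D) to X are colorings of D: each point of the diagram
   gets a color just before and just after it, locally constant away from the
   classical crossings and subject to the crossing relations. It is enough to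
   match the colorings of the two sides of each move by a bijection that
   commutes with endomorphisms of X.

   Reparametrizations and planar isotopies carry the colorings along; the
   Jacobian of an isotopy starts at 1 and never vanishes, so that signs of
   crossings are kept. In the other moves the colorings are unchanged outside
   some strands, and it remains to see that on both sides of the move the
   colors of the ends of the strands are subject to the same conditions and
   determine the inner colors. At a crossing any color of the understrand and
   any color of the overstrand determine the other two: this settles the second
   move. The first move holds because x |-> x |> x is injective, hence bijective
   as X is finite. The third move is given by the exchange laws when all strands
   run from left to right, and the other orientations follow. *)
Require Import Defs.
From mathcomp Require Import all_boot all_order all_algebra.
From mathcomp Require Import all_classical all_reals all_analysis.
From mathcomp Require Import all_fingroup zify lra ring.
Set Implicit Arguments.
Unset Strict Implicit.
Unset Printing Implicit Defensive.
Import Order.TTheory GRing.Theory Num.Theory.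
Import numFieldNormedType.Exports.
Local Open Scope classical_set_scope.

(** * Crossing relations *)

(** Colors live on points because the semiarcs of the two sides of a move do not correspond: a new
    crossing can split a semiarc that runs far outside the disk, while the points outside the
    strands are common to both diagrams. A strand of a Reidemeister or detour move has at most two
    cut points, so its coloring amounts to three colors [v0], [v1], [v2]. The outer two are shared
    by both sides, and each of these moves becomes a statement about [v1], to which
    [tangle_move_quiver] applies.

    Orientations and heights would multiply the cases. Reversing one strand of a crossing only
    exchanges the two colors of the other, and [regular] is stable under this. In the third move a
    reversal thus becomes a conjugation by second moves, and only the rightward braid needs the
    exchange laws. Its heights are totally ordered, which leaves six patterns out of eight, and its
    types are admissible because equality of components is transitive.

    Crossing signs come from the order of graphs: where one graph passes above another its slope is
    at least as large, and transversality excludes equality. *)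

Section Crossings.
Variable X : mcBiquandleType.
Implicit Types (l : ctype) (C : X -> X -> X -> X -> Prop).

Definition xing l (x x' y y' : X) : Prop := x' = utri l x y /\ y' = otri l y x.

Lemma utri_inj l (y : X) : injective (fun x => utri l x y).
Proof. exact: (bij_inj (under_bij l y)). Qed.

Lemma otri_inj l (y : X) : injective (fun x => otri l x y).
Proof. exact: (bij_inj (over_bij l y)). Qed.

Lemma switch_inj l (x x' y y' : X) :
  otri l y x = otri l y' x' -> utri l x y = utri l x' y' -> x = x' /\ y = y'.
Proof.
move=> e1 e2; suff [-> ->] : (x, y) = (x', y') by [].
by apply: (bij_inj (switch_bij l)); rewrite /= e1 e2.
Qed.

Lemma switch_surj l (u v : X) : exists x y, otri l y x = u /\ utri l x y = v.
Proof.
have [g _ gK] := switch_bij (s := X) l.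
by have := gK (u, v); case: (g (u, v)) => x y /= [<- <-]; exists x, y.
Qed.

(** By [over_diag] the switch sends [(x, x)] to the pair with both components [utri single x x], and
    the switch is injective. *)
Lemma diag_inj : injective (fun x : X => utri single x x).
Proof.
by move=> x y /= e; have [|//|] := @switch_inj single x y x y; rewrite ?over_diag.
Qed.

(** The orbit of [y] under the injective diagonal repeats itself; cancelling the diagonal down to
    index 0 exhibits [y] itself as a value. *)
Lemma diag_surj (fX : finite_set [set: X]) (y : X) :
  exists x, utri single x x = y.
Proof.
pose d (x : X) := utri single x x; pose o i := iter i d y.
have [i [j [ij e]]] : exists i j, (i < j)%N /\ o i = o j.
  apply: contrapT => no; apply: infinite_nat.
  have oinj : {in [set: nat] &, injective o}.
    move=> i j _ _ e; apply: contrapT => /eqP; rewrite neq_ltn => /orP[] ij.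
      by apply: no; exists i, j.
    by apply: no; exists j, i.
  by rewrite -(eq_finite_set (inj_card_eq oinj)); exact: sub_finite_set fX.
elim: i j ij e => [|i IH] [//|j] ij e; first by exists (o j).
by apply: (IH j) => //; exact: diag_inj e.
Qed.

(* Colours on the two sides of a crossing: [f] (resp. [g]) tells which of the
   two colors of the first (resp. second) strand is given. *)
Definition regular C := forall (f g : bool) a c, exists! p : X * X,
  C (if f then p.1 else a) (if f then a else p.1)
    (if g then p.2 else c) (if g then c else p.2).

(** The effect of reversing strands: reversing the second strand exchanges its right and left sides,
    that is, the two colors of the first strand, and conversely. *)
Definition flip_colors (f g : bool) C : X -> X -> X -> X -> Prop :=
  fun a b c d => C (if f then b else a) (if f then a else b)
                   (if g then d else c) (if g then c else d).

Lemma regular_flip f g C : regular C -> regular (flip_colors f g C).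
Proof.
move=> rC f' g' a c; have := rC (f (+) f') (g (+) g') a c.
by rewrite /flip_colors; case: f f' g g' => [] [] [] [].
Qed.

Lemma regular_swap C : regular C -> regular (fun a b c d => C c d a b).
Proof.
move=> rC f g a c; have [[p q] /= [Cpq u]] := rC g f c a.
exists (q, p); split=> //= -[q' p'] /= Cpq'.
by have [-> ->] := u (p', q') Cpq'.
Qed.

Lemma regular_ex C f g a c : regular C -> exists b d,
  C (if f then b else a) (if f then a else b)
    (if g then d else c) (if g then c else d).
Proof. by move=> /(_ f g a c) [[b d] [h _]]; exists b, d. Qed.

Lemma regular_uniq C f g a b c d b' d' : regular C ->
  C (if f then b else a) (if f then a else b)
    (if g then d else c) (if g then c else d) ->
  C (if f then b' else a) (if f then a else b')
    (if g then d' else c) (if g then c else d') -> b = b' /\ d = d'.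
Proof.
by move=> /(_ f g a c) [p [_ u]] h h'; have := u (b, d) h; have := u (b', d') h' => -> [].
Qed.

(** This is where axiom (ii) enters: the four choices of known colors use in turn the inverse of the
    switch, of [utri l ^~ y], of [otri l ^~ y], and the operations themselves. *)
Lemma regular_xing l : regular (xing l).
Proof.
move=> [] [] a c; rewrite /xing.
- have [x [y [e1 e2]]] := switch_surj l c a; exists (x, y); split=> //= -[x' y'] /= [h1 h2].
  by have [||-> ->] := @switch_inj l x x' y y'; rewrite -?h1 -?h2 ?e1 ?e2.
- have [g gK Kg] := under_bij l c; exists (g a, otri l c (g a)).
  by split=> [|[x' y']] /=; [rewrite Kg|move=> [-> ->]; rewrite gK].
- have [g gK Kg] := over_bij l a; exists (utri l a (g c), g c).
  by split=> [|[x' y']] /=; [rewrite Kg|move=> [-> ->]; rewrite gK].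
- by exists (utri l a c, otri l c a); split=> //= -[x' y'] /= [-> ->].
Qed.

(* The two sides of the third Reidemeister move; [a k] and [b k] are the
   colors of the left and right ends of strand k, and a crossing relation
   takes the colors of each strand below and above the other one. *)
Definition braid_left C01 C02 C12 (a0 a1 a2 m0 m1 m2 b0 b1 b2 : X) : Prop :=
  [/\ C01 a0 m0 m1 a1, C02 m0 b0 m2 a2 & C12 m1 b1 b2 m2].

Definition braid_right C01 C02 C12 (a0 a1 a2 n0 n1 n2 b0 b1 b2 : X) : Prop :=
  [/\ C12 a1 n1 n2 a2, C02 a0 n0 b2 n2 & C01 n0 b0 b1 n1].

Definition braided C01 C02 C12 := forall a0 a1 a2 m0 m1 m2 b0 b1 b2,
  braid_left C01 C02 C12 a0 a1 a2 m0 m1 m2 b0 b1 b2 ->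
  exists n0 n1 n2, braid_right C01 C02 C12 a0 a1 a2 n0 n1 n2 b0 b1 b2.

Section Braided.
Variables C01 C02 C12 : X -> X -> X -> X -> Prop.
Hypotheses (r01 : regular C01) (r02 : regular C02) (r12 : regular C12).

Lemma braid_left_inj a0 a1 a2 m0 m1 m2 b0 b1 b2 m0' m1' m2' b0' b1' b2' :
  braid_left C01 C02 C12 a0 a1 a2 m0 m1 m2 b0 b1 b2 ->
  braid_left C01 C02 C12 a0 a1 a2 m0' m1' m2' b0' b1' b2' ->
  [/\ m0 = m0', m1 = m1' & m2 = m2'].
Proof.
move=> [h1 h2 h3] [h1' h2' h3'].
have [e0 e1] := regular_uniq (f := false) (g := true) r01 h1 h1'; subst m0' m1'.
by have [_ ->] := regular_uniq (f := false) (g := true) r02 h2 h2'.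
Qed.

Lemma braid_right_inj a0 a1 a2 m0 m1 m2 b0 b1 b2 m0' m1' m2' b0' b1' b2' :
  braid_right C01 C02 C12 a0 a1 a2 m0 m1 m2 b0 b1 b2 ->
  braid_right C01 C02 C12 a0 a1 a2 m0' m1' m2' b0' b1' b2' ->
  [/\ m0 = m0', m1 = m1' & m2 = m2'] /\ [/\ b0 = b0', b1 = b1' & b2 = b2'].
Proof.
move=> [h1 h2 h3] [h1' h2' h3'].
have [e0 e1] := regular_uniq (f := false) (g := true) r12 h1 h1'; subst m1' m2'.
have [e0 e1] := regular_uniq (f := false) (g := true) r02 h2 h2'; subst m0' b2'.
by have [-> ->] := regular_uniq (f := false) (g := true) r01 h3 h3'.
Qed.

(** Regularity builds a left side on the given left ends. The move turns it into a right side which,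
    being determined by its left ends, has the prescribed right ends. *)
Lemma braided_sym a0 a1 a2 n0 n1 n2 b0 b1 b2 : braided C01 C02 C12 ->
  braid_right C01 C02 C12 a0 a1 a2 n0 n1 n2 b0 b1 b2 ->
  exists m0 m1 m2, braid_left C01 C02 C12 a0 a1 a2 m0 m1 m2 b0 b1 b2.
Proof.
move=> yb hr.
have [m0 [m1 h1]] := regular_ex false true a0 a1 r01.
have [c0 [m2 h2]] := regular_ex false true m0 a2 r02.
have [c1 [c2 h3]] := regular_ex false true m1 m2 r12.
have hl : braid_left C01 C02 C12 a0 a1 a2 m0 m1 m2 c0 c1 c2 by [].
have [n0' [n1' [n2' hr']]] := yb _ _ _ _ _ _ _ _ _ hl.
by have [_ [-> -> ->]] := braid_right_inj hr hr'; exists m0, m1, m2.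
Qed.

(* Flipping a strand conjugates the move by second Reidemeister moves: the
   strand is pushed back across the crossing of the other two, and the
   determinism of that crossing identifies the colors. *)
Lemma braided_flip0 : braided C01 C02 C12 ->
  braided (flip_colors false true C01) (flip_colors false true C02) C12.
Proof.
move=> yb a0 a1 a2 m0 m1 m2 b0 b1 b2 [h1 h2 h3].
have [n1 [n2 h12]] := regular_ex false true a1 a2 r12.
have [//|p0 [p1 [p2 [g1 g2 g3]]]] := yb a0 m1 m2 m0 a1 a2 b0 n1 n2.
have [e1 e2] := regular_uniq (f := false) (g := true) r12 h3 g1; subst p1 p2.
by exists p0, n1, n2.
Qed.

Lemma braided_flip1 : braided C01 C02 C12 ->
  braided (flip_colors true false C01) C02 (flip_colors false true C12).
Proof.
move=> yb a0 a1 a2 m0 m1 m2 b0 b1 b2 [h1 h2 h3].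
have [n0 [n2 h02]] := regular_ex false false a0 b2 r02.
have [//|p0 [p1 [p2 [g1 g2 g3]]]] := yb m0 a1 n2 a0 m1 b2 n0 b1 m2.
have [e1 e2] := regular_uniq (f := false) (g := false) r02 h2 g2; subst p0 p2.
by exists n0, p1, n2.
Qed.

Lemma braided_flip2 : braided C01 C02 C12 ->
  braided C01 (flip_colors true false C02) (flip_colors true false C12).
Proof.
move=> yb a0 a1 a2 m0 m1 m2 b0 b1 b2 [h1 h2 h3].
have [n0 [n1 h01]] := regular_ex true false b0 b1 r01.
have [//|p0 [p1 [p2 [g1 g2 g3]]]] := yb n0 n1 a2 b0 b1 m2 m0 m1 b2.
have [e1 e2] := regular_uniq (f := true) (g := false) r01 h1 g3; subst p0 p1.
by exists n0, n1, p2.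
Qed.
End Braided.

(* The crossing of strand k, which goes up, with strand l; [u] says that k is
   the understrand, [dk] and [dl] that k and l are oriented leftwards. *)
Definition cross t (u dk dl : bool) : X -> X -> X -> X -> Prop :=
  flip_colors dl dk (fun a b c d => if u then xing t a b c d else xing t c d a b).

Lemma regular_cross t u dk dl : regular (cross t u dk dl).
Proof.
apply: regular_flip; case: u; first exact: regular_xing.
exact: regular_swap (regular_xing t).
Qed.

(** [a], [b], [c] stand for the equalities between three components, two of which imply the third.
    The admissible triples are exactly those that do not contain precisely two [single]. *)
Lemma mc_tripleP (a b c : bool) : (a -> b -> c) -> (b -> c -> a) -> (c -> a -> b) ->
  let t (e : bool) := if e then single else multi in
  mc_triple (t a) (t b) (t c).
Proof.
case: a; case: b; case: c => //= h1 h2 h3; try exact: Tsss.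
all: by [exact: Tsmm|exact: Tmsm|exact: Tmms|exact: Tmmm
  |have := h1 isT isT|have := h2 isT isT|have := h3 isT isT].
Qed.

Lemma braided_laws j k l (u01 u02 u12 : bool) :
  mc_triple j k l -> mc_triple k j l -> mc_triple j l k ->
  mc_triple l j k -> mc_triple k l j -> mc_triple l k j ->
  (u01 -> u12 -> u02) -> (~~ u01 -> ~~ u12 -> ~~ u02) ->
  braided (cross l u01 false false) (cross k u02 false false)
    (cross j u12 false false).
Proof.
move=> t1 t2 t3 t4 t5 t6 hu hu' a0 a1 a2 m0 m1 m2 b0 b1 b2.
rewrite /braid_left /cross /flip_colors /=.
case=> c01 c02 c12.
(* The right side is forced: [a0] and [b2] enter the crossing of strands 0 and 2, which gives [n0]
   and [n2]; then [a1] and [n2] give [n1]. *)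
exists (if u02 then utri k a0 b2 else otri k a0 b2).
exists (if u12 then utri j a1 (if u02 then otri k b2 a0 else utri k b2 a0)
        else otri j a1 (if u02 then otri k b2 a0 else utri k b2 a0)).
exists (if u02 then otri k b2 a0 else utri k b2 a0).
rewrite /braid_right; move: hu hu' c01 c02 c12.
(* Acyclic heights leave six patterns. On the left every color is an expression in [a0], [m1] and
   [b2], and the equations that remain, for [n1], [a2] and [b0], are exchange laws in these
   three. *)
case: u01 u12 u02 => [] [] [] //= hu hu' [-> ->] [-> ->] [-> ->];
  do ?split => //; try by [have := hu isT isT|have := hu' isT isT].
all: by [exact: exchange_oo|exact: exchange_uo|exact: exchange_uu
  |exact/esym/exchange_oo|exact/esym/exchange_uo|exact/esym/exchange_uu].
Qed.

(** [cross] with a reversed strand is by definition a [flip_colors] of the unreversed one, so the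
    three strands can be reversed one at a time. *)
Lemma braided_cross j k l (u01 u02 u12 : bool) :
  mc_triple j k l -> mc_triple k j l -> mc_triple j l k ->
  mc_triple l j k -> mc_triple k l j -> mc_triple l k j ->
  (u01 -> u12 -> u02) -> (~~ u01 -> ~~ u12 -> ~~ u02) ->
  forall d0 d1 d2 : bool,
  braided (cross l u01 d0 d1) (cross k u02 d0 d2) (cross j u12 d1 d2).
Proof.
move=> t1 t2 t3 t4 t5 t6 hu hu' d0 d1 d2.
have := braided_laws t1 t2 t3 t4 t5 t6 hu hu'.
set b := braided _ _ _ => b0.
have {b0} b1 : braided (cross l u01 d0 false) (cross k u02 d0 false) (cross j u12 false false).
  by case: d0 => //; apply: (braided_flip0 (C01 := cross l u01 _ _)) b0; exact: regular_cross.
have {b1} b2 : braided (cross l u01 d0 d1) (cross k u02 d0 false) (cross j u12 d1 false).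
  case: d1 => //. apply: (braided_flip1) b1; exact: regular_cross.
case: d2 => //; apply: braided_flip2 b2; exact: regular_cross.
Qed.

End Crossings.

(** * Colorings and the fundamental mc-biquandle *)

(** An existential form of [bijective], from which [cid] can extract an inverse. *)
Lemma bijective_inverse (T U : Type) (f : T -> U) : bijective f ->
  exists h : U -> T, cancel f h /\ cancel h f.
Proof. by case=> h; exists h. Qed.

Section Evaluation.
Variables (X : mcBiquandleType) (G : Type) (g : G -> X).

Definition alpha_inv l (y x : X) : X :=
  let: exist h _ := cid (bijective_inverse (under_bij l y)) in h x.

Definition beta_inv l (y x : X) : X :=
  let: exist h _ := cid (bijective_inverse (over_bij l y)) in h x.

Definition switch_inv l (p : X * X) : X * X :=
  let: exist h _ := cid (bijective_inverse (switch_bij (s := X) l)) in h p.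

Lemma alpha_invK l (y x : X) : alpha_inv l y (utri l x y) = x.
Proof. by rewrite /alpha_inv; case: cid => h [hK _]; exact: hK. Qed.

Lemma alpha_invVK l (y x : X) : utri l (alpha_inv l y x) y = x.
Proof. by rewrite /alpha_inv; case: cid => h [_ Kh]; exact: Kh. Qed.

Lemma beta_invK l (y x : X) : beta_inv l y (otri l x y) = x.
Proof. by rewrite /beta_inv; case: cid => h [hK _]; exact: hK. Qed.

Lemma beta_invVK l (y x : X) : otri l (beta_inv l y x) y = x.
Proof. by rewrite /beta_inv; case: cid => h [_ Kh]; exact: Kh. Qed.

Lemma switch_invK l (x y : X) : switch_inv l (otri l y x, utri l x y) = (x, y).
Proof. by rewrite /switch_inv; case: cid => h [hK _]; exact: (hK (x, y)). Qed.

Lemma switch_invVK l (p : X * X) : let q := switch_inv l p in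
  (otri l q.2 q.1, utri l q.1 q.2) = p.
Proof. by rewrite /switch_inv; case: cid => h [_ Kh]; exact: Kh. Qed.

Fixpoint eval (w : mcWord G) : X :=
  match w with
  | WGen a => g a
  | WUnder l x y => utri l (eval x) (eval y)
  | WOver l x y => otri l (eval x) (eval y)
  | WAlphaInv l y x => alpha_inv l (eval y) (eval x)
  | WBetaInv l y x => beta_inv l (eval y) (eval x)
  | WSInv1 l u v => (switch_inv l (eval u, eval v)).1
  | WSInv2 l u v => (switch_inv l (eval u, eval v)).2
  end.

Variable rels : mcWord G -> mcWord G -> Prop.
Hypothesis eval_rels : forall w w', rels w w' -> eval w = eval w'.

Lemma eval_cong w w' : mcCong rels w w' -> eval w = eval w'.
Proof.
elim=> //= {w w'}; try by move=> *; congruence.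
- by move=> x; exact: over_diag.
- by move=> *; rewrite alpha_invK.
- by move=> *; rewrite alpha_invVK.
- by move=> *; rewrite beta_invK.
- by move=> *; rewrite beta_invVK.
- by move=> *; rewrite switch_invK.
- by move=> *; rewrite switch_invK.
- by move=> l u v; have [] := switch_invVK l (eval u, eval v).
- by move=> l u v; have [] := switch_invVK l (eval u, eval v).
- by move=> *; exact: exchange_oo.
- by move=> *; exact: exchange_uo.
- by move=> *; exact: exchange_uu.
Qed.

Definition eval_presented (x : presented rels) : X := eval (prepr x).

Lemma eval_presentedE w : eval_presented (pclass rels w) = eval w.
Proof. exact: eval_cong (preprP _ _). Qed.

Definition eval_hom : mcHom (presented rels) X :=
  @McHom (presented rels) X eval_presented
    (fun _ _ _ => eval_presentedE _) (fun _ _ _ => eval_presentedE _).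

End Evaluation.

Lemma mcHom_eq (Y X : mcBiquandleType) (f g : mcHom Y X) : f =1 g -> f = g.
Proof.
case: f g => [f fu fo] [g gu go] /= /funext e; subst g.
by congr McHom; exact: Prop_irrelevance.
Qed.

Section PresentedExt.
Variables (X : mcBiquandleType) (G : Type) (rels : mcWord G -> mcWord G -> Prop).
Variables (f g : mcHom (presented rels) X).

(** A homomorphism is only assumed to preserve the four operations. Its values on the inverse words
    are recovered from the equations that these words satisfy, by injectivity of the operations and
    of the switch. *)
Lemma presented_hom_ext :
  (forall a, f (pclass rels (WGen a)) = g (pclass rels (WGen a))) -> f = g.
Proof.
move=> fg; apply: mcHom_eq => x; rewrite -(preprK x).
have hU (h : mcHom (presented rels) X) l w w' :
    h (pclass rels (WUnder l w w')) = utri l (h (pclass rels w)) (h (pclass rels w')).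
  by rewrite -(mcHom_under h) -p_underE.
have hO (h : mcHom (presented rels) X) l w w' :
    h (pclass rels (WOver l w w')) = otri l (h (pclass rels w)) (h (pclass rels w')).
  by rewrite -(mcHom_over h) -p_overE.
have S1 l u v := (pclassP rels _ _).1 (CSVK1 rels l u v).
have S2 l u v := (pclassP rels _ _).1 (CSVK2 rels l u v).
elim: (prepr x) => // {x} l w e w' e'.
- by rewrite !hU e e'.
- by rewrite !hO e e'.
- have E := (pclassP rels _ _).1 (CAlphaVK rels l w' w).
  by apply: (@utri_inj X l (f (pclass rels w))); rewrite /= {2}e -!hU E.
- have E := (pclassP rels _ _).1 (CBetaVK rels l w' w).
  by apply: (@otri_inj X l (f (pclass rels w))); rewrite /= {2}e -!hO E.
- by have [] := @switch_inj X l (f (pclass rels (WSInv1 l w w')))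
    (g (pclass rels (WSInv1 l w w'))) (f (pclass rels (WSInv2 l w w')))
    (g (pclass rels (WSInv2 l w w'))); rewrite -?hU -?hO ?S1 ?S2.
- by have [] := @switch_inj X l (f (pclass rels (WSInv1 l w w')))
    (g (pclass rels (WSInv1 l w w'))) (f (pclass rels (WSInv2 l w w')))
    (g (pclass rels (WSInv2 l w w'))); rewrite -?hU -?hO ?S1 ?S2.
Qed.
End PresentedExt.

(** * One-sided neighborhoods, cut points and semiarcs *)

Section Germs.
Local Open Scope ring_scope.
Variable R : realType.

Lemma near_rightP (x : R) (P : R -> Prop) :
  (\forall u \near x^'+, P u) <->
  exists2 e, 0 < e & forall u, x < u < x + e -> P u.
Proof.
split=> [|[e e0 h]].
  rewrite near_withinE => /nbhs_ballP[e /= e0 h]; exists e => // u /andP[xu ue].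
  by apply: h => //; rewrite /ball /= ltr_distlC; apply/andP; split; lra.
rewrite near_withinE; apply/nbhs_ballP; exists e => //= u.
rewrite /ball /= ltr_distlC => /andP[_ ue] xu; apply: h; lra.
Qed.

Lemma near_leftP (x : R) (P : R -> Prop) :
  (\forall u \near x^'-, P u) <->
  exists2 e, 0 < e & forall u, x - e < u < x -> P u.
Proof.
split=> [|[e e0 h]].
  rewrite near_withinE => /nbhs_ballP[e /= e0 h]; exists e => // u /andP[xu ue].
  by apply: h => //; rewrite /ball /= ltr_distlC; apply/andP; split; lra.
rewrite near_withinE; apply/nbhs_ballP; exists e => //= u.
rewrite /ball /= ltr_distlC => /andP[ue _] xu; apply: h; lra.
Qed.

Definition on_side (b : bool) (x e u : R) : Prop :=
  if b then x < u < x + e else x - e < u < x.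

Definition near_side (b : bool) (x : R) (P : R -> Prop) : Prop :=
  exists2 e, 0 < e & forall u, on_side b x e u -> P u.

Lemma near_sideI b x P Q :
  near_side b x P -> near_side b x Q -> near_side b x (fun u => P u /\ Q u).
Proof.
move=> [e e0 h] [e' e'0 h']; exists (Num.min e e'); first by rewrite lt_min e0.
by move=> u hu; split; [apply: h|apply: h']; move: hu; rewrite /on_side;
   case: (b); case: (leP e e'); lra.
Qed.

Lemma near_side_mono b x (P Q : R -> Prop) :
  (forall u, P u -> Q u) -> near_side b x P -> near_side b x Q.
Proof. by move=> PQ [e e0 h]; exists e => // u /h /PQ. Qed.

Lemma near_side_ex b x P : near_side b x P -> exists u, P u.
Proof.
move=> [e e0 h]; exists (if b then x + e / 2 else x - e / 2).
by apply: h; rewrite /on_side; case: (b); lra.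
Qed.

Lemma near_side_dist b x e (P : R -> Prop) : 0 < e ->
  (forall u, `|u - x| < e -> u != x -> P u) -> near_side b x P.
Proof.
move=> e0 h; exists e => // u; rewrite /on_side; case: b => hu; apply: h.
- by rewrite ltr_norml; lra.
- by rewrite gt_eqF//; case/andP: hu.
- by rewrite ltr_norml; lra.
- by rewrite lt_eqF//; case/andP: hu.
Qed.

Variable n : nat.
Implicit Types p q r : circle_point R n.

Lemma same_refl p : same_point p p.
Proof. by split=> //; exists 0; rewrite addr0. Qed.

Lemma same_sym p q : same_point p q -> same_point q p.
Proof. by move=> [e [k h]]; split=> //; exists (- k); rewrite h rmorphN /= addrK. Qed.

Lemma same_trans p q r : same_point p q -> same_point q r -> same_point p r.
Proof.
move=> [e [k h]] [e' [l h']]; split; first by rewrite e.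
by exists (l + k); rewrite h h' rmorphD /= addrA.
Qed.

Lemma same_shift i u (k : int) : same_point (i, u + k%:~R) ((i, u) : circle_point R n).
Proof. by split=> //; exists k. Qed.

Section Diagram.
Variable D : diagram R n.

Lemma cut_same p q : same_point p q -> cut_point D p -> cut_point D q.
Proof.
by move=> pq [r [h|h]]; exists r; [left|right]; apply: above_same h => //; exact: same_refl.
Qed.

Lemma cut_shift i u (k : int) : cut_point D (i, u + k%:~R) <-> cut_point D (i, u).
Proof. by split; apply: cut_same; [|apply: same_sym]; exact: same_shift. Qed.

Lemma cut_crossing p : cut_point D p -> exists q, crossing (curve D) p q.
Proof.
move=> [q [/above_crossing h|/above_crossing [h e]]]; exists q => //.
by split=> // /same_sym.
Qed.

(** [curve_finite] only concerns parameters in [[0, 1[]. The cut points at distance less than 1 from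
    [p] are translates of those by one of three consecutive integers, hence form a finite and so
    closed set. *)
Lemma cut_isolated p :
  exists2 e, 0 < e & forall u, `|u - p.2| < e -> u != p.2 -> ~ cut_point D (p.1, u).
Proof.
pose F : set R := snd @` [set p | 0 <= p.2 < 1 /\ exists q, crossing (curve D) p q].
have fF : finite_set F by exact/finite_image/curve_finite.
pose k0 := Num.floor p.2.
pose A := [set u : R | cut_point D (p.1, u) /\ `|u - p.2| < 1 /\ u != p.2].
have fA : finite_set A.
  pose sh (k : int) (f : R) : R := f + k%:~R.
  apply: (@sub_finite_set _ _ (sh k0 @` F `|` (sh (k0 - 1) @` F `|` sh (k0 + 1) @` F))); last first.
    by rewrite !finite_setU; do !split; exact: finite_image.
  move=> u [cu [du _]].
  have hF : F (u - (Num.floor u)%:~R).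
    exists (p.1, u - (Num.floor u)%:~R) => //=; split.
      by have := floor_itv u; rewrite intrD /=; lra.
    by apply: cut_crossing; rewrite -rmorphN; apply/cut_shift.
  have : Num.floor u = k0 \/ Num.floor u = k0 - 1 \/ Num.floor u = k0 + 1.
    have := floor_itv u; have := floor_itv p.2; rewrite -/k0 !intrD /= => h1 h2.
    move: du; rewrite ltr_norml => /andP[d1 d2].
    have : (Num.floor u)%:~R < (k0 + 2)%:~R :> R by rewrite intrD; lra.
    have : (k0 - 2)%:~R < (Num.floor u)%:~R :> R by rewrite intrD rmorphN /=; lra.
    rewrite !ltr_int; lia.
  by case=> [e|[e|e]]; [left|right; left|right; right];
     exists (u - (Num.floor u)%:~R) => //; rewrite /sh -e subrK.
have cA : closed A.
  have /accessible_finite_set_closed : accessible_space R.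
    exact/hausdorff_accessible/Rhausdorff.
  exact.
have : nbhs p.2 (~` A).
  by apply: open_nbhs_nbhs; split; [exact: closed_openC|move=> [_ [_]]; rewrite eqxx].
move=> /nbhs_ballP[e /= e0 h]; exists (Num.min e 1); first by rewrite lt_min e0 ltr01.
move=> u; rewrite lt_min => /andP[ue u1] up cu; apply: (h u) => //.
by rewrite /ball /= distrC.
Qed.

Definition uncut_between i (s t : R) : Prop :=
  forall u, Num.min s t <= u <= Num.max s t -> ~ cut_point D (i, u).

Lemma uncut_betweenC i s t : uncut_between i s t -> uncut_between i t s.
Proof. by move=> h u; rewrite minC maxC; exact: h. Qed.

Lemma uncut_between_trans i s t u :
  uncut_between i s t -> uncut_between i t u -> uncut_between i s u.
Proof.
move=> h h' w hw; case: (pselect (Num.min s t <= w <= Num.max s t)) => [/h//|nw].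
move/negP: nw; rewrite negb_and -!ltNge => nw; apply: h'; move: hw nw.
by case: (leP s u); case: (leP s t); case: (leP t u) => ? ? ? ? /orP[]; lra.
Qed.

Lemma uncut_between_shift i s t (k : int) :
  uncut_between i s t -> uncut_between i (s + k%:~R) (t + k%:~R).
Proof.
move=> h u; rewrite -addr_minl -addr_maxl => hu cu.
apply: (h (u - k%:~R)); last by rewrite -rmorphN; apply/cut_shift.
by move: hu; lra.
Qed.

Lemma joined_sym p q : joined D p q -> joined D q p.
Proof.
move=> [e [k h]]; split=> //; exists (- k).
have /uncut_betweenC := @uncut_between_shift _ _ _ (- k) h.
by rewrite e rmorphN /= addrK.
Qed.

Lemma joined_trans p q r : joined D p q -> joined D q r -> joined D p r.
Proof.
move=> [e [k h]] [e' [k' h']]; split; first by rewrite e.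
exists (k' + k); apply: uncut_between_trans h _.
by rewrite e rmorphD /= addrA; exact: uncut_between_shift.
Qed.

Lemma joined_uncut p q : joined D p q -> ~ cut_point D q.
Proof.
move=> [e [k h]]; have : ~ cut_point D (p.1, q.2 + k%:~R).
  by apply: h; rewrite ge_min le_max !lexx !orbT.
by rewrite cut_shift e; case: q {e h}.
Qed.

Lemma joined_refl p : ~ cut_point D p -> joined D p p.
Proof.
move=> np; split=> //; exists 0; rewrite addr0 => u.
by rewrite minxx maxxx => /le_anti <-; case: p np.
Qed.

Lemma joined_same p q : ~ cut_point D p -> same_point q p -> joined D p q.
Proof.
move=> np [e [k h]]; split=> //; exists (- k); rewrite h rmorphN /= addrK => u.
by rewrite minxx maxxx => /le_anti <-; case: p np {e h}.
Qed.

Implicit Types A B : semiarc D.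

Lemma semiarc_eq A B q : semiarc_set A q -> semiarc_set B q -> A = B.
Proof.
case: A B => [A [p np eA]] [B [p' np' eB]] /=; subst A B => /= jp jp'.
have e : [set q | joined D p q] = [set q | joined D p' q].
  have pp' := joined_trans jp (joined_sym jp').
  apply/seteqP; split=> r /= h; last exact: joined_trans pp' h.
  exact: joined_trans (joined_sym pp') h.
move: (ex_intro2 _ _ _ _ _) (ex_intro2 _ _ _ _ _); rewrite e => a b.
by congr Semiarc; exact: Prop_irrelevance.
Qed.

Lemma semiarc_mem A : exists p, semiarc_set A p.
Proof. by case: A => [A [p np eA]]; exists p; rewrite /= eA; exact: joined_refl. Qed.

Lemma semiarc_uncut A p : semiarc_set A p -> ~ cut_point D p.
Proof. by case: A => [A [q np eA]] /=; rewrite eA; exact: joined_uncut. Qed.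

Lemma semiarc_joined A p q : semiarc_set A p -> semiarc_set A q <-> joined D p q.
Proof.
case: A => [A [r np eA]] /=; rewrite eA => h; split=> [h'|]; last exact: joined_trans.
exact: joined_trans (joined_sym h) h'.
Qed.

Lemma semiarc_through p : ~ cut_point D p -> exists A, semiarc_set A p.
Proof.
move=> np; exists (Semiarc (ex_intro2 _ _ p np erefl)).
exact: joined_refl.
Qed.

Definition adjacent (b : bool) A p : Prop := near_side b p.2 (fun u => semiarc_set A (p.1, u)).

Lemma startsP A p : starts_at A p <-> adjacent true A p.
Proof. exact: near_rightP. Qed.

Lemma endsP A p : ends_at A p <-> adjacent false A p.
Proof. exact: near_leftP. Qed.

Lemma near_side_uncut b p : near_side b p.2 (fun u => ~ cut_point D (p.1, u)).
Proof. by have [e e0 h] := cut_isolated p; apply: near_side_dist e0 h. Qed.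

Lemma adjacent_ex b p : exists A, adjacent b A p.
Proof.
have [e e0 h] := near_side_uncut b p.
have [u0 hu0] : exists u, on_side b p.2 e u.
  by apply: (@near_side_ex b p.2); exists e.
have [A Au0] := semiarc_through (h _ hu0).
exists A, e => // u hu; apply/(semiarc_joined _ Au0); split=> //; exists 0 => w /=.
rewrite addr0 => hw; apply: h; move: hu0 hu hw; rewrite /on_side.
by case: (b); case: (leP u0 u); lra.
Qed.

Lemma adjacent_uniq b A B p : adjacent b A p -> adjacent b B p -> A = B.
Proof.
by move=> h h'; have [u [Au Bu]] := near_side_ex (near_sideI h h'); exact: semiarc_eq Au Bu.
Qed.

Lemma adjacent_mem b A p : semiarc_set A p -> adjacent b A p.
Proof.
move=> Ap; have [e e0 h] := near_side_uncut b p.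
have np := semiarc_uncut Ap.
exists e => // u hu; apply/(semiarc_joined _ Ap); split=> //; exists 0 => w /=.
rewrite addr0 => hw; have [->|wp] := eqVneq w p.2; first by case: (p) np.
apply: h; move: hu hw wp; rewrite /on_side neq_lt.
by case: (b); case: (leP p.2 u); lra.
Qed.

Lemma adjacent_same b A p q : same_point p q -> adjacent b A p -> adjacent b A q.
Proof.
move=> [e [k ek]] [d d0 h]; exists d => // u hu.
have Au : semiarc_set A (p.1, u + k%:~R).
  by apply: h; move: hu; rewrite /on_side ek; case: (b); lra.
apply/(semiarc_joined _ Au); rewrite -e; apply: joined_same (semiarc_uncut Au) _.
exact/same_sym/same_shift.
Qed.

(** The semiarc just after [p] ([b = true]) or just before it; away from the cut points the two
    agree. *)
Definition germ b p : semiarc D := projT1 (cid (adjacent_ex b p)).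

Lemma germP b p : adjacent b (germ b p) p.
Proof. by rewrite /germ; case: cid. Qed.

Lemma germE b A p : adjacent b A p -> germ b p = A.
Proof. exact/adjacent_uniq/germP. Qed.

End Diagram.
End Germs.

(** * Colorings of points and homomorphisms from the fundamental mc-biquandle *)

Section Colorings.
Local Open Scope ring_scope.
Variables (R : realType) (X : mcBiquandleType).

(* The relations at a crossing, between the colors [qL], [qR] of the
   understrand before and after the crossing and those of the overstrand. *)
Definition crossing_colors (pos : bool) l (qL qR pL pR : X) : Prop :=
  if pos then xing l qL qR pR pL else xing l qR qL pL pR.

Section Diagram.
Variables (n : nat) (D : diagram R n).
Implicit Types (p q : circle_point R n) (c : bool -> circle_point R n -> X).

(* [c true p] is the color just after [p], and [c false p] just before. *)
Record coloring c : Prop := Coloring {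
  coloring_same : forall b p q, same_point p q -> c b p = c b q;
  coloring_uncut : forall p, ~ cut_point D p -> c false p = c true p;
  coloring_near : forall b p, near_side b p.2 (fun u => forall b', c b' (p.1, u) = c b p);
  coloring_crossing : forall p q, above D p q ->
    crossing_colors `[< positive D p q >] (crossing_type p q)
      (c false q) (c true q) (c false p) (c true p)
}.

(** A connectedness argument: [E] collects the parameters up to which the color has not changed, and
    its supremum must be [t]. The ends may be cut points, hence the color after [s] and the color
    before [t]. *)
Lemma coloring_between c i s t : coloring c -> s < t ->
  (forall u, s < u < t -> ~ cut_point D (i, u)) -> c true (i, s) = c false (i, t).
Proof.
move=> hc st nc.
pose E := [set u | s <= u <= t /\ forall w, s < w <= u -> c false (i, w) = c true (i, s)].
have Es : E s by split=> [|w h]; [|exfalso]; lra.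
have hE : has_sup E by split; [exists s|exists t => u [/andP[]]].
have sm : s <= sup E by apply: ub_le_sup => //; exact: hE.2.
have mt : sup E <= t by apply: ge_sup; [exists s|move=> u [/andP[]]].
have below w : s < w < sup E -> c false (i, w) = c true (i, s).
  move=> /andP[sw wm]; have w0 : 0 < sup E - w by lra.
  by have [u [_ Eu] wu] := sup_adherent w0 hE; apply: Eu; rewrite sw /=; lra.
have Em : E (sup E).
  split=> [|w /andP[sw]]; first by rewrite sm.
  rewrite le_eqVlt => /orP[/eqP wm|wm]; last by apply: below; rewrite sw.
  have [e e0 he] := coloring_near hc false (i, sup E).
  have [u [hu1 hu2]] : exists u, (s < u < sup E) /\ (sup E - e < u < sup E).
    exists ((Num.max s (sup E - e) + sup E) / 2).
    by subst w; case: (leP s (sup E - e)) => ?; split; lra.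
  by rewrite wm -(he u hu2 false) /= below.
have [mlt|] := ltP (sup E) t; last first.
  move=> tm; have em : sup E = t by apply/le_anti; rewrite mt tm.
  by case: Em => _ /(_ t)<-//; rewrite em st lexx.
have cm : c true (i, sup E) = c true (i, s).
  have [->//|ms] := eqVneq (sup E) s.
  have sm' : s < sup E by rewrite lt_neqAle eq_sym ms.
  by rewrite -(coloring_uncut hc) ?(Em.2 (sup E))// ?sm' ?lexx//; apply: nc; rewrite sm'.
have [e e0 he] := coloring_near hc true (i, sup E).
(* A point beyond [sup E] but not beyond [t], within the radius where the color after [sup E]
   persists; it would belong to [E]. *)
pose u := Num.min t (sup E + e / 2).
have hu : sup E < u <= t /\ u < sup E + e.
  by rewrite /u; case: (leP t (sup E + e / 2)) => ?; split; lra.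
suff /(ub_le_sup hE.2) : E u by move=> ?; exfalso; lra.
split=> [|w /andP[sw wu]]; first by lra.
have [wm|mw] := leP w (sup E); first by apply: Em.2; rewrite sw.
by rewrite (he w) ?cm // /on_side /=; lra.
Qed.

Lemma coloring_uncut_between c b b' i s t : coloring c ->
  uncut_between D i s t -> c b (i, s) = c b' (i, t).
Proof.
move=> hc h.
have unc b1 b2 w : Num.min s t <= w <= Num.max s t -> c b1 (i, w) = c b2 (i, w).
  by move=> /h/(coloring_uncut hc); case: b1 b2 => [] [].
have Ms w : Num.min w t <= w <= Num.max w t by rewrite ge_min le_max lexx.
have Mt w : Num.min s w <= w <= Num.max s w by rewrite ge_min le_max lexx !orbT.
have [st|ts|e] := ltgtP s t; last by subst s; apply: unc.
- rewrite (unc b true s (Ms _)) (unc b' false t (Mt _)).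
  by apply: coloring_between => // u su; apply: h; move: su; case: (leP s t) => ? ?; lra.
- rewrite (unc b false s (Ms _)) (unc b' true t (Mt _)).
  by apply/esym/coloring_between => // u su; apply: h; move: su; case: (leP s t) => ? ?; lra.
Qed.

Lemma coloring_joined c b b' p q : coloring c -> joined D p q -> c b p = c b' q.
Proof.
move=> hc [e [k h]]; case: p q e h => i s [j t] /= <- h.
rewrite (coloring_uncut_between b b' hc h); apply: coloring_same hc _ _ _ _.
exact: same_shift.
Qed.

Definition hom_coloring (f : mcHom (MCB D) X) : bool -> circle_point R n -> X :=
  fun b p => f (pclass (@crossing_relation R n D) (WGen (germ D b p))).

Lemma hom_coloringP f : coloring (hom_coloring f).
Proof.
split=> [b p q pq|p np|b p|p q ab].
- rewrite /hom_coloring; congr (f (pclass _ (WGen _))).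
  exact/germE/(adjacent_same (same_sym pq))/germP.
- have [A Ap] := semiarc_through np.
  by rewrite /hom_coloring !(germE (adjacent_mem _ Ap)).
- apply: near_side_mono (germP D b p) => u hu b'.
  by rewrite /hom_coloring (germE (adjacent_mem _ hu)).
have rel (x y x' y' : semiarc D) : crossing_semiarcs p q x y x' y' ->
    let h A := f (pclass (@crossing_relation R n D) (WGen A)) in
    xing (crossing_type p q) (h x) (h x') (h y) (h y').
  move=> hx h; rewrite /xing /h -(mcHom_under f) -(mcHom_over f).
  split; congr (f _).
    apply: etrans (esym (p_underE (@crossing_relation R n D) _ _ _)).
    by apply/pclassP/CRel; exact: UnderRelation hx.
  apply: etrans (esym (p_overE (@crossing_relation R n D) _ _ _)).
  by apply/pclassP/CRel; exact: OverRelation hx.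
rewrite /crossing_colors; case: asboolP => pos.
  by apply: rel; split=> //; left; split=> //; split;
    [apply/endsP|apply/startsP|apply/startsP|apply/endsP]; exact: germP.
by apply: rel; split=> //; right; split=> //; split;
  [apply/startsP|apply/endsP|apply/endsP|apply/startsP]; exact: germP.
Qed.

Lemma hom_coloring_inj : injective hom_coloring.
Proof.
move=> f g e; apply: presented_hom_ext => A.
have [p Ap] := semiarc_mem A.
have := congr1 (fun c => c true p) e.
by rewrite /hom_coloring (germE (adjacent_mem _ Ap)).
Qed.

(** A semiarc receives the color of any of its points, since joined points have equal colors. The
    crossing condition of [c] then says that evaluation respects the relations of the
    presentation. *)
Lemma hom_coloring_surj c : coloring c -> exists f, hom_coloring f = c.
Proof.
move=> hc.
pose g (A : semiarc D) := c true (projT1 (cid (semiarc_mem A))).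
have gE b A p : adjacent b A p -> g A = c b p.
  move=> Ap; have [u [Au cu]] := near_side_ex (near_sideI Ap (coloring_near hc b p)).
  rewrite /g; case: cid => q /= Aq; rewrite -(cu true).
  by apply: coloring_joined hc _; apply/(semiarc_joined _ Aq).
have grel w w' : crossing_relation w w' -> eval g w = eval g w'.
  have rel p q (x y x' y' : semiarc D) : crossing_semiarcs p q x y x' y' ->
      xing (crossing_type p q) (g x) (g x') (g y) (g y').
    move=> [ab h]; have := coloring_crossing hc ab; rewrite /crossing_colors.
    case: asboolP => pos; case: h => -[pos' [h1 h2 h3 h4]] //.
      rewrite (gE _ _ _ ((endsP _ _).1 h1)) (gE _ _ _ ((startsP _ _).1 h2)).
      by rewrite (gE _ _ _ ((startsP _ _).1 h3)) (gE _ _ _ ((endsP _ _).1 h4)).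
    rewrite (gE _ _ _ ((startsP _ _).1 h1)) (gE _ _ _ ((endsP _ _).1 h2)).
    by rewrite (gE _ _ _ ((endsP _ _).1 h3)) (gE _ _ _ ((startsP _ _).1 h4)).
  by case=> p q x y x' y' /rel[].
exists (eval_hom grel); apply/funext => b; apply/funext => p.
by rewrite -(gE _ _ _ (germP D b p)); exact: (eval_presentedE grel (WGen (germ D b p))).
Qed.

End Diagram.
End Colorings.

(** * Quiver isomorphisms and matchings of colorings *)

Lemma quiver_iso_refl Q : quiver_iso Q Q.
Proof. by exists id, id; split=> //; exists id. Qed.

Lemma quiver_iso_sym Q Q' : quiver_iso Q Q' -> quiver_iso Q' Q.
Proof.
move=> [fv [fe [[gv gvK Kgv] [ge geK Kge] hs ht]]]; exists gv, ge.
split=> [||e|e]; [by exists fv|by exists fe| |].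
- by rewrite -{2}(Kge e) hs gvK.
- by rewrite -{2}(Kge e) ht gvK.
Qed.

Lemma quiver_iso_trans Q Q' Q'' :
  quiver_iso Q Q' -> quiver_iso Q' Q'' -> quiver_iso Q Q''.
Proof.
move=> [fv [fe [bv be hs ht]]] [gv [ge [bv' be' hs' ht']]].
exists (gv \o fv), (ge \o fe); split=> [||e|e]; try exact: bij_comp.
- by rewrite /= hs' hs.
- by rewrite /= ht' ht.
Qed.

Section QuiverIso.
Variables (R : realType) (X : mcBiquandleType) (S : set (mcEnd X)).

(** An edge is a pair of a vertex and an element of [S], so a bijection of vertices commuting with
    composition carries the edges along with unchanged labels. *)
Lemma quiver_iso_bij n n' (D : diagram R n) (D' : diagram R n')
    (F : mcHom (MCB D) X -> mcHom (MCB D') X) : bijective F ->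
  (forall (phi : mcEnd X) f, F (mcComp phi f) = mcComp phi (F f)) ->
  quiver_iso (coloring_quiver S (existT _ n D)) (coloring_quiver S (existT _ n' D')).
Proof.
move=> bF Fphi; exists F, (fun e => (F e.1, e.2)); split=> // [|e]; last by rewrite /= Fphi.
have [G GK KG] := bF.
by exists (fun e => (G e.1, e.2)) => -[f phi] /=; rewrite ?GK ?KG.
Qed.

(** A relation is more convenient than a map: a move prescribes the new coloring only outside its
    strands. The bijection comes from choice, and uniqueness makes it commute with endomorphisms as
    soon as [T] is stable under them. *)
Lemma quiver_iso_colorings n n' (D : diagram R n) (D' : diagram R n')
    (T : (bool -> circle_point R n -> X) -> (bool -> circle_point R n' -> X) -> Prop) :
  (forall c, coloring D c -> exists2 c', coloring D' c' & T c c') ->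
  (forall c', coloring D' c' -> exists2 c, coloring D c & T c c') ->
  (forall c c1 c2, coloring D c -> coloring D' c1 -> coloring D' c2 ->
    T c c1 -> T c c2 -> c1 = c2) ->
  (forall c' c1 c2, coloring D' c' -> coloring D c1 -> coloring D c2 ->
    T c1 c' -> T c2 c' -> c1 = c2) ->
  (forall (phi : mcEnd X) c c', T c c' ->
    T (fun b p => phi (c b p)) (fun b p => phi (c' b p))) ->
  quiver_iso (coloring_quiver S (existT _ n D)) (coloring_quiver S (existT _ n' D')).
Proof.
move=> ex ex' un un' nat.
have /choice[F hF] : forall f : mcHom (MCB D) X, exists f' : mcHom (MCB D') X,
    T (hom_coloring f) (hom_coloring f').
  move=> f; have [c' /hom_coloring_surj[f' <-] h] := ex _ (hom_coloringP f).
  by exists f'.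
have /choice[G hG] : forall f : mcHom (MCB D') X, exists f' : mcHom (MCB D) X,
    T (hom_coloring f') (hom_coloring f).
  move=> f; have [c' /hom_coloring_surj[f' <-] h] := ex' _ (hom_coloringP f).
  by exists f'.
apply: (@quiver_iso_bij _ _ _ _ F) => [|phi f].
- exists G => f; apply: hom_coloring_inj.
    exact: un' (hom_coloringP _) (hom_coloringP _) (hom_coloringP _) (hG _) (hF _).
  exact: un (hom_coloringP _) (hom_coloringP _) (hom_coloringP _) (hF _) (hG _).
- apply: hom_coloring_inj.
  apply: un (hom_coloringP _) (hom_coloringP _) (hom_coloringP _) (hF _) _.
  exact: nat (hF f).
Qed.

Lemma quiver_iso_pullback n n' (D : diagram R n) (D' : diagram R n')
    (Phi : circle_point R n' -> circle_point R n) : bijective Phi ->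
  (forall c : bool -> circle_point R n -> X,
    coloring D c <-> coloring D' (fun b p => c b (Phi p))) ->
  quiver_iso (coloring_quiver S (existT _ n D)) (coloring_quiver S (existT _ n' D')).
Proof.
move=> [Psi PhiK PsiK] hc.
apply: (@quiver_iso_colorings _ _ _ _ (fun c c' => forall b p, c' b p = c b (Phi p))).
- by move=> c /hc h; exists (fun b p => c b (Phi p)).
- move=> c' hc'; exists (fun b p => c' b (Psi p)); last by move=> b p; rewrite PhiK.
  apply/hc; suff -> : (fun b p => c' b (Psi (Phi p))) = c' by [].
  by apply/funext => b; apply/funext => p; rewrite PhiK.
- by move=> c c1 c2 _ _ _ h1 h2; apply/funext => b; apply/funext => p; rewrite h1 h2.
- move=> c c1 c2 _ _ _ h1 h2; apply/funext => b; apply/funext => p.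
  by rewrite -(PsiK p) -h1 -h2.
- by move=> phi c c' h b p; rewrite h.
Qed.

End QuiverIso.

(** * Reparametrizations and planar isotopies *)

Section Calculus.
Local Open Scope ring_scope.
Variable R : realType.

Lemma derive1_comp_real (V : normedModType R) (f : R -> R) (g : R -> V) x :
  derivable f x 1 -> derivable g (f x) 1 ->
  derive1 (fun t => g (f t)) x = derive1 f x *: derive1 g (f x).
Proof.
move=> df dg; have Df := (derivable1_diffP f x).1 df.
have Dg := (derivable1_diffP g (f x)).1 dg.
rewrite (derive1E' (f := g \o f)); last exact: differentiable_comp.
by rewrite diff_comp//= (deriv1E dg) (deriv1E df) scale1r.
Qed.

Lemma derive1_comp_diff (V W : normedModType R) (f : R -> V) (g : V -> W) x :
  derivable f x 1 -> differentiable g (f x) ->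
  derive1 (fun t => g (f t)) x = 'd g (f x) (derive1 f x).
Proof.
move=> df Dg; have Df := (derivable1_diffP f x).1 df.
rewrite (derive1E' (f := g \o f)); last exact: differentiable_comp.
by rewrite diff_comp//= (deriv1E df) scale1r.
Qed.

Lemma det2Z (a b : R) (v w : R * R) : det2 (a *: v) (b *: w) = a * b * det2 v w.
Proof. rewrite /det2 /= /GRing.scale /=; ring. Qed.

Lemma det2_diff (f : R * R -> R * R) u v w : differentiable f u ->
  det2 ('d f u v) ('d f u w) = Defs.jacobian f u * det2 v w.
Proof.
move=> df; have E x : 'd f u x = x.1 *: 'd f u (1, 0) + x.2 *: 'd f u (0, 1).
  rewrite -!linearZ -linearD; congr ('d f u _).
  by apply: injective_projections; rewrite /= /GRing.scale /=; ring.
rewrite (E v) (E w) /Defs.jacobian /differential.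
move: ('d f u (1, 0)) ('d f u (0, 1)) => a b; rewrite /det2 /= /GRing.scale /=; ring.
Qed.

Lemma isotopy_jacobian (H : R -> R * R -> R * R) v :
  ambient_isotopy H -> 0 < Defs.jacobian (H 1) v.
Proof.
move=> [H0 _ _ Hd Hc].
pose J t := Defs.jacobian (H t) v.
have J0 : J 0 = 1.
  rewrite /J; have -> : H 0 = id by apply/funext.
  rewrite /Defs.jacobian /differential.
  have -> : 'd (@id (R * R)) v = id :> (R * R -> R * R).
    by have h := is_diff_id (v : (R * R)%type); rewrite [LHS]diff_val.
  by rewrite /det2 /=; ring.
(* Joint continuity on the cylinder, restricted to the segment over the fixed point [v]. *)
have dc w : {within `[0, 1], continuous (fun t => differential (H t) v w)}.
  apply/subspace_continuousP => t /= t01.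
  move: t01; rewrite in_itv /= => t01.
  have /subspace_continuousP/(_ (t, v) t01) h := Hc w.
  move=> A /h; rewrite /= !nbhs_simpl /= /within /= => hA.
  case: hA => -[B C] /= [nB nC] BC; apply: filterS nB => s Bs; rewrite in_itv /= => s01.
  by apply: (BC (s, v)) => //; split=> //; exact: nbhs_singleton nC.
have Jc : {within `[0, 1], continuous J}.
  have cfst : continuous (fst : R * R -> R) by move=> x; exact: cvg_fst.
  have csnd : continuous (snd : R * R -> R) by move=> x; exact: cvg_snd.
  have c1 w : {within `[0, 1], continuous (fun t => (differential (H t) v w).1)}.
    by move=> t; exact: (cvg_comp _ _ (dc w t) (cfst _)).
  have c2 w : {within `[0, 1], continuous (fun t => (differential (H t) v w).2)}.
    by move=> t; exact: (cvg_comp _ _ (dc w t) (csnd _)).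
  by move=> t; exact: (cvgB (cvgM (c1 _ t) (c2 _ t)) (cvgM (c2 _ t) (c1 _ t))).
rewrite -/(J 1) ltNge; apply/negP => J1.
have [|c] := @IVT R J 0 1 0 ler01 Jc.
  by rewrite J0 ge_min J1 orbT le_max ler01.
rewrite in_itv /= => c01 Jc0.
by have [_] := Hd c v c01.
Qed.

End Calculus.

Section Pullback.
Local Open Scope ring_scope.
Variables (R : realType) (X : mcBiquandleType) (n n' : nat).
Variables (D : diagram R n) (D' : diagram R n').
Variable Phi : circle_point R n' -> circle_point R n.
Hypothesis Phi_bij : bijective Phi.
Hypothesis Phi_same : forall p q, same_point p q <-> same_point (Phi p) (Phi q).
Hypothesis Phi_above : forall p q, above D' p q <-> above D (Phi p) (Phi q).
Hypothesis Phi_positive : forall p q, above D' p q ->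
  (positive D' p q <-> positive D (Phi p) (Phi q)).
Hypothesis Phi_comp : forall p q, (p.1 == q.1) = ((Phi p).1 == (Phi q).1).
Hypothesis Phi_near : forall b p (P : circle_point R n -> Prop),
  near_side b (Phi p).2 (fun v => P ((Phi p).1, v)) <->
  near_side b p.2 (fun u => P (Phi (p.1, u))).

(** A coloring sees nothing but equality of points, overcrossings, their signs, equality of
    components and one-sided neighborhoods, all of which [Phi] respects. *)
Lemma coloring_pullback (c : bool -> circle_point R n -> X) :
  coloring D c <-> coloring D' (fun b p => c b (Phi p)).
Proof.
have [Psi PhiK PsiK] := Phi_bij.
have cut p : cut_point D' p <-> cut_point D (Phi p).
  split=> [[q [/Phi_above h|/Phi_above h]]|[q]]; first by exists (Phi q); left.
    by exists (Phi q); right.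
  by rewrite -(PsiK q) => -[/Phi_above h|/Phi_above h]; exists (Psi q); [left|right].
have type p q : crossing_type p q = crossing_type (Phi p) (Phi q).
  by rewrite /crossing_type Phi_comp.
have pos p q : above D' p q ->
    `[< positive D' p q >] = `[< positive D (Phi p) (Phi q) >].
  by move=> /Phi_positive h; apply/asbool_equiv_eq.
split=> hc; split.
- by move=> b p q /Phi_same/(coloring_same hc b).
- by move=> p np; apply: (coloring_uncut hc) => /cut.
- by move=> b p; apply/(Phi_near b p (fun q => forall b', c b' q = c b (Phi p)))/(coloring_near hc).
- move=> p q h; rewrite type pos//; apply: (coloring_crossing hc).
  exact/Phi_above.
- by move=> b p q; rewrite -(PsiK p) -(PsiK q) => /Phi_same/(coloring_same hc b).
- by move=> p; rewrite -(PsiK p) => np; apply: (coloring_uncut hc) => /cut.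
- move=> b p; rewrite -(PsiK p).
  by apply/(Phi_near b _ (fun q => forall b', c b' q = c b (Phi (Psi p))))/(coloring_near hc).
- move=> p q; rewrite -(PsiK p) -(PsiK q) => /Phi_above h.
  by have := coloring_crossing hc h; rewrite type (pos _ _ h); apply.
Qed.

Lemma quiver_iso_transport (S : set (mcEnd X)) :
  quiver_iso (coloring_quiver S (existT _ n D)) (coloring_quiver S (existT _ n' D')).
Proof. exact: quiver_iso_pullback Phi_bij coloring_pullback. Qed.

End Pullback.

Section GlobalMoves.
Local Open Scope ring_scope.
Variables (R : realType) (X : mcBiquandleType) (S : set (mcEnd X)) (n : nat).
Variables D D' : diagram R n.

Lemma planar_isotopy_quiver : planar_isotopy D D' ->
  quiver_iso (coloring_quiver S (existT _ n D)) (coloring_quiver S (existT _ n D')).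
Proof.
move=> [H isoH [Hc Ha]]; have [_ _ _ Hd _] := isoH.
have dH v : differentiable (H 1) v by have [] := Hd 1 v; rewrite ?ler01 ?lexx.
have vel p : velocity (curve D') p =
    'd (H 1) (curve D p.1 p.2) (velocity (curve D) p).
  have -> : velocity (curve D') p = derive1 (fun t => H 1 (curve D p.1 t)) p.2.
    by rewrite /velocity; congr (derive1 _ _); apply/funext => t; rewrite Hc.
  apply: derive1_comp_diff; [exact: curve_derivable|exact: dH].
apply: (@quiver_iso_transport R X n n D D' id _ _ _ _ _ _ S).
- by exists id.
- by move=> p q; split.
- exact: Ha.
(* At a crossing both velocities sit at the same point of the plane, so the same differential, with
   positive determinant, transforms them. *)
- move=> p q /Ha/above_crossing[_ e]; rewrite /positive !vel e det2_diff; last exact: dH.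
  by rewrite pmulr_rgt0//; exact: isotopy_jacobian.
- by [].
- by move=> b [i t] P; split.
Qed.

Section Reparametrization.
Variables (phi : R -> R).
Hypothesis phi1 : forall t, phi (t + 1) = phi t + 1.
Hypothesis phi_derivable : forall t, derivable phi t 1 /\ 0 < derive1 phi t.

Lemma repar_int t (k : int) : phi (t + k%:~R) = phi t + k%:~R.
Proof.
have pern (m : nat) u : phi (u + m%:R) = phi u + m%:R.
  by elim: m u => [|m IH] u; rewrite ?addr0// -natr1 !addrA phi1 IH.
case: k => m; first exact: pern.
by rewrite NegzE rmorphN /= -[in RHS](subrK (m.+1%:~R) t) -!pmulrn pern addrK.
Qed.

Lemma repar_continuous : continuous phi.
Proof.
by move=> u; apply/differentiable_continuous/derivable1_diffP; have [] := phi_derivable u.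
Qed.

Lemma repar_mono : {mono phi : s t / s < t}.
Proof.
apply: leW_mono; apply: le_mono => s t st.
apply: (@gtr0_derive1_lt_cc R phi s t) => //.
- by move=> u _; have [] := phi_derivable u.
- by move=> u _; have [] := phi_derivable u.
- exact/continuous_subspaceT/repar_continuous.
- by rewrite in_itv /= lexx ltW.
- by rewrite in_itv /= lexx ltW.
Qed.

Lemma repar_surj v : exists t, phi t = v.
Proof.
(* By periodicity [v] lies between [phi k] and [phi (k + 1)], where the intermediate value theorem
   applies. *)
pose k := Num.floor (v - phi 0).
have := floor_itv (v - phi 0); rewrite -/k => vk.
have pk : phi k%:~R = phi 0 + k%:~R by rewrite -repar_int add0r.
have pk1 : phi (k + 1)%:~R = phi 0 + (k + 1)%:~R by rewrite -repar_int add0r.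
have k01 : k%:~R <= (k + 1)%:~R :> R by rewrite ler_int; lia.
have [|t _ <-] := IVT (v := v) k01 (continuous_subspaceT repar_continuous); last by exists t.
rewrite pk pk1; move: vk; rewrite !intrD /= => vk.
by case: (leP (phi 0 + k%:~R) (phi 0 + (k%:~R + 1%:~R))) => ?; lra.
Qed.

Lemma repar_near b t (P : R -> Prop) :
  near_side b (phi t) P <-> near_side b t (fun u => P (phi u)).
Proof.
split=> -[e e0 h].
  have [s es] := repar_surj (if b then phi t + e else phi t - e).
  exists (if b then s - t else t - s).
    by rewrite fun_if !subr_gt0; case: b es {h} => es; rewrite -repar_mono es; lra.
  move=> u; rewrite /on_side => hu; apply: h; move: es hu; rewrite /on_side.
  case: (b) => es; rewrite ?subrKC ?subKr => hu.
    by rewrite -es !repar_mono; lra.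
  by rewrite -es !repar_mono; lra.
exists (if b then phi (t + e) - phi t else phi t - phi (t - e)).
  by rewrite fun_if !subr_gt0 !repar_mono; case: (b); lra.
move=> v; have [u <-] := repar_surj v => hu; apply: h; move: hu; rewrite /on_side.
by case: (b); rewrite ?subrKC ?subKr !repar_mono.
Qed.

End Reparametrization.

Lemma reparametrization_quiver : reparametrization D D' ->
  quiver_iso (coloring_quiver S (existT _ n D)) (coloring_quiver S (existT _ n D')).
Proof.
move=> [s [phi [p1 dphi _ hc ha]]].
pose Phi (p : circle_point R n) : circle_point R n := (s p.1, phi p.1 p.2).
have phi_inj i : injective (phi i).
  move=> u v e; have mono := repar_mono (dphi i).
  by case: (ltgtP u v) => //; rewrite -mono e ltxx.
apply: (@quiver_iso_transport _ _ _ _ _ _ Phi).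
- have /choice[Psi PsiK] : forall q, exists p, Phi p = q.
    move=> [j v]; have [t et] := repar_surj (p1 (s^-1 j)%g) (dphi _) v.
    by exists ((s^-1)%g j, t); rewrite /Phi /= et permKV.
  exists Psi => // p; have [/perm_inj e1 e2] := PsiK (Phi p).
  apply: injective_projections => //; apply: (phi_inj p.1).
  by rewrite -e2 e1.
- move=> p q; split=> -[e [k h]].
    by split; [rewrite /= e|exists k; rewrite /= h e repar_int].
  have {}e := perm_inj e; split=> //; exists k; apply: (phi_inj p.1).
  by rewrite repar_int// {2}e; exact: h.
- by [].
(* Velocities are multiplied by positive factors, so the sign of their determinant is kept. *)
- move=> p q _; have vel p' : velocity (curve D') p' =
      derive1 (phi p'.1) p'.2 *: velocity (curve D) (Phi p').
    rewrite -derive1_comp_real; [|exact: (dphi _ _).1|exact: curve_derivable].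
    by congr derive1; apply/funext => t; rewrite hc.
  rewrite /positive !vel det2Z pmulr_rgt0//.
  by rewrite mulr_gt0 ?(dphi _ _).2.
- by move=> p q /=; rewrite (inj_eq perm_inj).
- by move=> b p P; exact: (repar_near (p1 _) (dphi _) b p.2 (fun v => P (s p.1, v))).
Qed.

End GlobalMoves.

(** * Moves inside a family of strands *)

Section Strands.
Local Open Scope ring_scope.
Variables (R : realType) (n : nat).
Implicit Types (J K : strand R n) (p q : circle_point R n).

Lemma on_inside J p : inside_strand J p -> on_strand J p.
Proof. by move=> [e [k h]]; split=> //; exists k; lra. Qed.

Lemma on_strand_same J p q : same_point p q -> on_strand J p -> on_strand J q.
Proof.
move=> [e [k h]] [e' [m h']]; split; first by rewrite -e.
by exists (k + m); rewrite rmorphD /=; move: h'; rewrite h; lra.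
Qed.

Lemma inside_strand_same J p q : same_point p q -> inside_strand J p -> inside_strand J q.
Proof.
move=> [e [k h]] [e' [m h']]; split; first by rewrite -e.
by exists (k + m); rewrite rmorphD /=; move: h'; rewrite h; lra.
Qed.

Lemma on_strand_point J p : on_strand J p ->
  exists2 u, J.2.1 <= u <= J.2.2 & same_point p (J.1, u).
Proof.
move=> [e [k h]]; exists (p.2 + k%:~R) => //; split=> //.
by exists (- k); rewrite /= rmorphN /= addrK.
Qed.

Lemma inside_strand_point J p : inside_strand J p ->
  exists2 u, J.2.1 < u < J.2.2 & same_point p (J.1, u).
Proof.
move=> [e [k h]]; exists (p.2 + k%:~R) => //; split=> //.
by exists (- k); rewrite /= rmorphN /= addrK.
Qed.

Lemma strand_inside J u : J.2.1 < u < J.2.2 -> inside_strand J (J.1, u).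
Proof. by split=> //; exists 0; rewrite addr0. Qed.

Lemma strand_on J u : J.2.1 <= u <= J.2.2 -> on_strand J (J.1, u).
Proof. by split=> //; exists 0; rewrite addr0. Qed.

Lemma int_close (k m : int) (x : R) : x + k%:~R < x + m%:~R + 1 ->
  x + m%:~R < x + k%:~R + 1 -> k = m.
Proof.
move=> h1 h2; have : (k%:~R < (m + 1)%:~R :> R) by rewrite intrD /=; lra.
have : (m%:~R < (k + 1)%:~R :> R) by rewrite intrD /=; lra.
rewrite !ltr_int; lia.
Qed.

(** A proper strand is shorter than a full turn, so no two of its parameters differ by a nonzero
    integer. *)
Lemma strand_param_uniq J (u v : R) : proper_strand J ->
  J.2.1 <= u <= J.2.2 -> J.2.1 <= v <= J.2.2 ->
  same_point ((J.1, u) : circle_point R n) (J.1, v) -> u = v.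
Proof.
rewrite /proper_strand => pJ hu hv [_ [k /= e]].
suff k0 : k = 0 by rewrite e k0 addr0.
by apply: (@int_close _ _ v); rewrite addr0; lra.
Qed.

(** The interval is the closed gap between two consecutive lifts of the open strand. *)
Lemma strand_window J i (u : R) (k : int) :
  J.2.2 - 1 <= u + k%:~R <= J.2.1 -> ~ inside_strand J (i, u).
Proof.
move=> hu [_ [m /= hm]].
have : (k%:~R < m%:~R :> R) by lra.
rewrite ltr_int => km; have : ((k + 1)%:~R <= m%:~R :> R) by rewrite ler_int; lia.
by rewrite intrD /=; lra.
Qed.

(* [b = true] looks to the right of [p], where only the start of a strand can
   lead inside it. *)
Lemma strand_side J b p : proper_strand J -> ~ inside_strand J p ->
  near_side b p.2 (fun u => ~ inside_strand J (p.1, u)) \/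
  same_point p (J.1, if b then J.2.1 else J.2.2).
Proof.
rewrite /proper_strand => pJ nin; have [e|ne] := pselect (p.1 = J.1); last first.
  by left; exists 1 => // u _ [].
(* With [a] and [b] the ends of [J], [w] is the lift of [p] in [[a, a + 1[]. It is [a], [b] or
   beyond [b], and the gaps of [strand_window] give the sides that stay outside. *)
pose k := - Num.floor (p.2 - J.2.1); pose w := p.2 + k%:~R.
have hw : J.2.1 <= w < J.2.1 + 1.
  have := floor_itv (p.2 - J.2.1); rewrite /w /k rmorphN intrD /=; lra.
have win : ~ (J.2.1 < w < J.2.2) by move=> h; apply: nin; split=> //; exists k.
have pw : same_point p (J.1, w) by split=> //; exists (- k); rewrite /= rmorphN /= /w addrK.
have [wa|wa] := eqVneq w J.2.1.
  case: b; first by right; rewrite -wa.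
  left; exists (J.2.1 - (J.2.2 - 1)); first by lra.
  move=> u; rewrite /on_side => hu; apply: (@strand_window _ _ _ k).
  by move: wa; rewrite /w; lra.
have {}hw : J.2.1 < w < J.2.1 + 1 by rewrite lt_neqAle eq_sym wa; lra.
have wb : J.2.2 <= w by rewrite leNgt; apply/negP => h; apply: win; lra.
have [wb'|wb'] := eqVneq w J.2.2.
  case: b; last by right; rewrite -wb'.
  left; exists (J.2.1 + 1 - w); first by lra.
  move=> u; rewrite /on_side => hu; apply: (@strand_window _ _ _ (k - 1)).
  move: wb wb' hu; rewrite intrB /= /w => wb wb2 hu; lra.
have {}wb : J.2.2 < w by rewrite lt_neqAle eq_sym wb'.
left; exists (if b then J.2.1 + 1 - w else w - J.2.2); first by case: (b); lra.
move=> u hu; apply: (@strand_window _ _ _ (k - 1)); move: hu hw wb.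
by rewrite intrB /= /on_side /w; case: (b); lra.
Qed.

Lemma curve_shift (D : diagram R n) i t (k : int) : curve D i (t + k%:~R) = curve D i t.
Proof.
have pern (m : nat) u : curve D i (u + m%:R) = curve D i u.
  by elim: m u => [|m IH] u; rewrite ?addr0// -natr1 addrA curve_periodic IH.
case: k => m; first exact: pern.
by rewrite NegzE rmorphN /= -(pern m.+1 (t - _)) -pmulrn subrK.
Qed.

Lemma velocity_same (D : diagram R n) p q :
  same_point p q -> velocity (curve D) p = velocity (curve D) q.
Proof.
move=> [e [k h]]; rewrite /velocity e h.
have sh x : derivable (shift (- k%:~R : R)) x 1.
  by apply: ex_derive; exact: is_derive_shift.
have d1 x : derive1 (shift (- k%:~R : R)) x = 1.
  by rewrite derive1E; exact: (congr1 (fun f => f x) (derive_shift 1 (- k%:~R : R))).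
have E : (fun t => curve D q.1 (shift (- k%:~R) t)) = curve D q.1.
  by apply/funext => t; rewrite /= -rmorphN curve_shift.
have := derive1_comp_real (sh (q.2 + k%:~R)) (@curve_derivable _ _ D q.1 _).
by rewrite E d1 scale1r => ->; rewrite /= addrK.
Qed.

(** A derivative depends only on the germ of the curve; this preserves crossing signs away from the
    strands. *)
Lemma velocity_near (D D' : diagram R n) p (A : set (circle_point R n)) :
  (forall q, ~ A q -> curve D' q.1 q.2 = curve D q.1 q.2) ->
  (forall b, near_side b p.2 (fun u => ~ A (p.1, u))) -> ~ A p ->
  velocity (curve D') p = velocity (curve D) p.
Proof.
move=> h nA np; rewrite /velocity !derive1E; apply: near_eq_derive => //.
have [e e0 he] := nA true; have [e' e'0 he'] := nA false.
apply/nbhs_ballP; exists (Num.min e e') => /=; first by rewrite lt_min e0.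
move=> u; rewrite /ball /= lt_min !ltr_distlC => hu.
have [up|up|->] := ltgtP u p.2; last by rewrite h//; case: (p) np.
- by rewrite (h (p.1, u))//; apply: he'; rewrite /on_side; lra.
- by rewrite (h (p.1, u))//; apply: he; rewrite /on_side; lra.
Qed.

End Strands.

Section Step.
Local Open Scope ring_scope.
Variables (R : realType) (X : Type).

(* The color of a strand cut at [t1] and [t2], just before ([b = false]) or
   just after ([b = true]) the parameter [u]. *)
Definition step (t1 t2 : R) (v0 v1 v2 : X) (b : bool) (u : R) : X :=
  if (if b then u < t1 else u <= t1) then v0
  else if (if b then u < t2 else u <= t2) then v1 else v2.

Lemma step_near t1 t2 v0 v1 v2 b u : t1 < t2 ->
  near_side b u (fun u' => forall b',
    step t1 t2 v0 v1 v2 b' u' = step t1 t2 v0 v1 v2 b u).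
Proof.
move=> t12.
(* Close to [u] on side [b], comparisons with the cuts are strict and have the truth value that
   [step] reads at [u]. *)
have key : near_side b u (fun u' =>
    ((u' < t1 <-> if b then u < t1 else u <= t1) /\ u' != t1) /\
    ((u' < t2 <-> if b then u < t2 else u <= t2) /\ u' != t2)).
  have cut t : near_side b u (fun u' => (u' < t <-> if b then u < t else u <= t) /\ u' != t).
    case: b; [have [h|h] := ltP u t|have [h|h] := leP u t].
    - exists (t - u); rewrite ?subr_gt0// /on_side => u' hu.
      by split; [split; lra|rewrite lt_eqF; lra].
    - by exists 1 => // u'; rewrite /on_side => hu; split; [split; lra|rewrite gt_eqF; lra].
    - by exists 1 => // u'; rewrite /on_side => hu; split; [split; lra|rewrite lt_eqF; lra].
    - exists (u - t); rewrite ?subr_gt0// /on_side => u' hu.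
      by split; [split; lra|rewrite gt_eqF; lra].
  exact: near_sideI.
apply: near_side_mono key => u' [[h1 n1] [h2 n2]] b'.
have cmp t (x : bool) : (u' < t <-> x) -> u' != t ->
    (if b' then u' < t else u' <= t) = x.
  move=> h n; rewrite le_eqVlt (negbTE n) /= if_same.
  by apply/idP/idP => /h.
by rewrite /step !(cmp _ _ h1 n1) !(cmp _ _ h2 n2).
Qed.

Lemma step_uncut t1 t2 v0 v1 v2 b u : u != t1 -> u != t2 ->
  step t1 t2 v0 v1 v2 b u = step t1 t2 v0 v1 v2 true u.
Proof. by case: b => // n1 n2; rewrite /step !le_eqVlt (negbTE n1) (negbTE n2). Qed.

Lemma step_lt t1 t2 v0 v1 v2 b u : u < t1 -> step t1 t2 v0 v1 v2 b u = v0.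
Proof. by rewrite /step; case: b => h; rewrite ?h ?ltW. Qed.

Lemma step_gt t1 t2 v0 v1 v2 b u : t1 < t2 -> t2 < u -> step t1 t2 v0 v1 v2 b u = v2.
Proof.
by rewrite /step; case: b => h12 h; rewrite !ifF //; apply/negbTE; rewrite -?leNgt -?ltNge; lra.
Qed.

Lemma step_slot t1 t2 v0 v1 v2 b (e : bool) : t1 < t2 ->
  step t1 t2 v0 v1 v2 b (if e then t2 else t1) =
    if e then if b then v2 else v1 else if b then v1 else v0.
Proof.
rewrite /step => h; case: e; case: b; rewrite ?ltxx ?lexx ?h// ifF//; apply/negbTE.
  by rewrite -leNgt ltW.
by rewrite -ltNge.
Qed.
End Step.

(** * Strands with two slots and their local colorings *)

Section Tangles.
Local Open Scope ring_scope.
Variables (R : realType) (X : mcBiquandleType) (n : nat) (I : finType).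
Variable J : I -> strand R n.
Hypothesis J_proper : forall k, proper_strand (J k).
Hypothesis J_disjoint : forall k l, k <> l -> disjoint_strands (J k) (J l).
Implicit Types (p q : circle_point R n) (k l : I) (e : bool).

(** The ends of the strands are [outside] without being [off]: they carry the boundary colors common
    to both diagrams. *)
Definition outside p : Prop := forall k, ~ inside_strand (J k) p.
Definition off p : Prop := forall k, ~ on_strand (J k) p.

Lemma off_outside p : off p -> outside p.
Proof. by move=> h k /on_inside/h. Qed.

Lemma on_strand_uniq k l p : on_strand (J k) p -> on_strand (J l) p -> k = l.
Proof.
move=> hk hl; apply: contrapT => /J_disjoint h.
by have : (on_strand (J k) `&` on_strand (J l)) p by []; rewrite h.
Qed.

Lemma param_uniq k l u v : (J k).2.1 <= u <= (J k).2.2 ->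
  (J l).2.1 <= v <= (J l).2.2 ->
  same_point (((J k).1, u) : circle_point R n) ((J l).1, v) -> k = l /\ u = v.
Proof.
move=> hu hv h; have kl : k = l.
  apply: (@on_strand_uniq _ _ ((J k).1, u)); first exact: strand_on.
  exact: on_strand_same (same_sym h) (strand_on hv).
by subst l; split=> //; exact: strand_param_uniq h.
Qed.

Lemma outside_end k u : u = (J k).2.1 \/ u = (J k).2.2 -> outside ((J k).1, u).
Proof.
have := J_proper k; rewrite /proper_strand => pk hu l /inside_strand_point[v hv h].
have hu' : (J k).2.1 <= u <= (J k).2.2 by case: hu => ->; lra.
have hv' : (J l).2.1 <= v <= (J l).2.2 by lra.
have [kl e] := param_uniq hu' hv' h; subst l v.
by move: hv; case: hu => ->; lra.
Qed.

Lemma outside_near b p : outside p ->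
  near_side b p.2 (fun u => outside (p.1, u)) \/
  exists k, same_point p ((J k).1, if b then (J k).2.1 else (J k).2.2).
Proof.
move=> op; have [h|h] := pselect (exists k,
  same_point p ((J k).1, if b then (J k).2.1 else (J k).2.2)); first by right.
left; have near_k k : near_side b p.2 (fun u => ~ inside_strand (J k) (p.1, u)).
  by have [//|] := strand_side b (J_proper k) (op k) => h'; case: h; exists k.
suff : near_side b p.2 (fun u => forall k, k \in enum I -> ~ inside_strand (J k) (p.1, u)).
  by apply: near_side_mono => u hu k; apply: hu; rewrite mem_enum.
elim: (enum I) => [|k s IH]; first by exists 1.
apply: near_side_mono (near_sideI (near_k k) IH) => u [h1 h2] l.
by rewrite inE => /orP[/eqP->|/h2].
Qed.

Lemma off_near b p : off p -> near_side b p.2 (fun u => outside (p.1, u)).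
Proof.
move=> op; have [//|[k h]] := outside_near b (off_outside op).
have := J_proper k; rewrite /proper_strand => pk.
case: (op k); apply: on_strand_same (same_sym h) _; apply: strand_on.
by case: (b); lra.
Qed.

Definition slot (t1 t2 : I -> R) k e : circle_point R n :=
  ((J k).1, if e then t2 k else t1 k).

(** A slot need not be a cut point, so that strands without crossings fit too. By [tangle_closed] no
    crossing joins a strand to the rest of the diagram. *)
Record tangle (D : diagram R n) (t1 t2 : I -> R) : Prop := Tangle {
  tangle_order : forall k, [/\ (J k).2.1 < t1 k, t1 k < t2 k & t2 k < (J k).2.2];
  tangle_cut : forall p k, cut_point D p -> on_strand (J k) p ->
    exists e, same_point p (slot t1 t2 k e);
  tangle_closed : forall p q k, above D p q \/ above D q p ->
    on_strand (J k) p -> exists l, on_strand (J l) q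
}.

Definition color_before (v0 v1 : I -> X) k e := if e then v1 k else v0 k.
Definition color_after (v1 v2 : I -> X) k e := if e then v2 k else v1 k.

Record local_coloring (D : diagram R n) (t1 t2 : I -> R) (v0 v1 v2 : I -> X) : Prop :=
LocalColoring {
  local_uncut : forall k e, ~ cut_point D (slot t1 t2 k e) ->
    color_before v0 v1 k e = color_after v1 v2 k e;
  local_crossing : forall k e l e', above D (slot t1 t2 k e) (slot t1 t2 l e') ->
    crossing_colors `[< positive D (slot t1 t2 k e) (slot t1 t2 l e') >]
      (if (J k).1 == (J l).1 then single else multi)
      (color_before v0 v1 l e') (color_after v1 v2 l e')
      (color_before v0 v1 k e) (color_after v1 v2 k e)
}.

Section OneTangle.
Variables (D : diagram R n) (t1 t2 : I -> R).
Hypothesis hD : tangle D t1 t2.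

Lemma slot_range k e : (J k).2.1 < (if e then t2 k else t1 k) < (J k).2.2.
Proof. by have [h1 h2 h3] := tangle_order hD k; case: e; lra. Qed.

Lemma slot_inside k e : inside_strand (J k) (slot t1 t2 k e).
Proof. exact/strand_inside/slot_range. Qed.

Lemma tangle_uncut k u : (J k).2.1 <= u <= (J k).2.2 -> u != t1 k -> u != t2 k ->
  ~ cut_point D ((J k).1, u).
Proof.
move=> hu n1 n2 /(tangle_cut hD)/(_ (strand_on hu))[e h].
have r := slot_range k e; have hv : (J k).2.1 <= (if e then t2 k else t1 k) <= (J k).2.2 by lra.
have [_ ue] := param_uniq hu hv h.
by move: n1 n2; rewrite ue; case: (e); rewrite eqxx.
Qed.

(** Slots are interior to the strands, so the end of a strand is never a cut point. *)
Lemma cut_outside_off p : cut_point D p -> outside p -> off p.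
Proof.
move=> cp op k /(tangle_cut hD cp)[e h]; apply: (op k).
exact: inside_strand_same (same_sym h) (slot_inside _ _).
Qed.

Lemma above_off p q : above D p q \/ above D q p -> off p -> off q.
Proof.
move=> h op k hq; have [|l] := tangle_closed hD (p := q) (q := p) _ hq.
  by case: h; [right|left].
exact: op.
Qed.

(** The slots cut the strand into three pieces, and [coloring_between] makes the color constant on
    each of them. *)
Lemma coloring_step (c : bool -> circle_point R n -> X) k u b :
  coloring D c -> (J k).2.1 <= u <= (J k).2.2 ->
  c b ((J k).1, u) = step (t1 k) (t2 k) (c true ((J k).1, (J k).2.1))
    (c true ((J k).1, t1 k)) (c true ((J k).1, (J k).2.2)) b u.
Proof.
move=> hc hu; have [r1 r2 r3] := tangle_order hD k.
have nc v : (J k).2.1 <= v <= (J k).2.2 -> v < t1 k \/ t1 k < v < t2 k \/ t2 k < v ->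
    ~ cut_point D ((J k).1, v).
  by move=> hv h; apply: tangle_uncut => //; rewrite neq_lt; lra.
have unc v b1 b2 : (J k).2.1 <= v <= (J k).2.2 ->
    v < t1 k \/ t1 k < v < t2 k \/ t2 k < v -> c b1 ((J k).1, v) = c b2 ((J k).1, v).
  by move=> hv /(nc _ hv)/(coloring_uncut hc); case: b1 b2 => [] [].
have btw s t : s < t -> (J k).2.1 <= s -> t <= (J k).2.2 ->
    t <= t1 k \/ t1 k <= s /\ t <= t2 k \/ t2 k <= s ->
    c true ((J k).1, s) = c false ((J k).1, t).
  by move=> st hs ht h; apply: (coloring_between hc) => // v hv; apply: nc; lra.
have [u1|u1|e1] := ltgtP u (t1 k).
- rewrite step_lt// (unc _ b false); [|lra..].
  have [->|ua] := eqVneq u (J k).2.1; first by apply: unc; lra.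
  by apply/esym/btw; move: ua; rewrite neq_lt; lra.
- have [u2|u2|e2] := ltgtP u (t2 k).
  + rewrite (unc _ b false); [|lra..].
    rewrite -(btw (t1 k) u); [|lra..].
    have n1 : (u < t1 k) = false by apply/negbTE; rewrite -leNgt ltW.
    have n2 : (u <= t1 k) = false by apply/negbTE; rewrite -ltNge.
    by rewrite /step n1 n2 u2 ltW//; case: (b).
  + rewrite step_gt// (unc _ b true); [|lra..].
    have [->//|ua] := eqVneq u (J k).2.2.
    rewrite (btw _ (J k).2.2); first (by apply: unc; lra); move: ua; rewrite neq_lt; lra.
  + have := @step_slot R X (t1 k) (t2 k) (c true ((J k).1, (J k).2.1))
      (c true ((J k).1, t1 k)) (c true ((J k).1, (J k).2.2)) b true r2.
    rewrite e2 => ->; case: b => /=.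
      rewrite (btw _ (J k).2.2); [|lra..]. by apply: unc; lra.
    by apply/esym/btw; lra.
- have := @step_slot R X (t1 k) (t2 k) (c true ((J k).1, (J k).2.1))
      (c true ((J k).1, t1 k)) (c true ((J k).1, (J k).2.2)) b false r2.
  rewrite e1 => ->; case: b => //=.
  by apply/esym/btw; lra.
Qed.

Lemma coloring_local (c : bool -> circle_point R n -> X) : coloring D c ->
  local_coloring D t1 t2 (fun k => c true ((J k).1, (J k).2.1))
    (fun k => c true ((J k).1, t1 k)) (fun k => c true ((J k).1, (J k).2.2)).
Proof.
move=> hc; have at_slot b k e : c b (slot t1 t2 k e) =
    if e then if b then c true ((J k).1, (J k).2.2) else c true ((J k).1, t1 k)
    else if b then c true ((J k).1, t1 k) else c true ((J k).1, (J k).2.1).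
  have [_ r2 _] := tangle_order hD k; have := slot_range k e => r.
  rewrite -(step_slot _ _ _ _ _ r2); apply: coloring_step => //.
  by move/andP: r => [/ltW-> /ltW->].
split=> [k e /(coloring_uncut hc)|k e l e' h]; first by rewrite !at_slot; case: e.
have := coloring_crossing hc h; rewrite !at_slot /color_before /color_after.
by case: e e' {h} => [] [].
Qed.

Lemma uncut_end k u : u = (J k).2.1 \/ u = (J k).2.2 -> ~ cut_point D ((J k).1, u).
Proof.
by have [r1 r2 r3] := tangle_order hD k; case=> ->; apply: tangle_uncut; rewrite ?neq_lt; lra.
Qed.

End OneTangle.
End Tangles.

(** * Replacing the inside of the strands *)

Section TangleMove.
Local Open Scope ring_scope.
Variables (R : realType) (X : mcBiquandleType) (n : nat) (I : finType).
Variable J : I -> strand R n.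
Hypothesis J_proper : forall k, proper_strand (J k).
Hypothesis J_disjoint : forall k l, k <> l -> disjoint_strands (J k) (J l).
Implicit Types (p q : circle_point R n) (k l : I) (e : bool).
Implicit Types (c : bool -> circle_point R n -> X).

Definition agree_outside (D D' : diagram R n) : Prop :=
  (forall p, outside J p -> curve D' p.1 p.2 = curve D p.1 p.2) /\
  (forall p q, outside J p -> outside J q -> (above D' p q <-> above D p q)).

Section Extension.
Variables (D D' : diagram R n) (t1 t2 t1' t2' : I -> R).
Hypotheses (hD : tangle J D t1 t2) (hD' : tangle J D' t1' t2').
Hypothesis DD' : agree_outside D D'.

Lemma cut_agree p : outside J p -> cut_point D p -> cut_point D' p.
Proof.
move=> op cp; have fp := cut_outside_off hD cp op; case: cp => q h.
have fq := above_off hD h fp; exists q.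
have oq := off_outside fq.
by case: h => h; [left; exact: (DD'.2 p q op oq).2|right; exact: (DD'.2 q p oq op).2].
Qed.

(** Around an [off] point both sides avoid the open strands, hence the two curves have the same
    velocity there. *)
Lemma positive_agree p q : off J p -> off J q -> positive D' p q <-> positive D p q.
Proof.
move=> fp fq; have vel r : off J r -> velocity (curve D') r = velocity (curve D) r.
  move=> fr; apply: (velocity_near (A := fun r => ~ outside J r)).
  - by move=> s /contrapT /DD'.1.
  - move=> b; apply: near_side_mono (off_near J_proper b fr) => u ou h; exact: (h ou).
  - by move=> h; exact: (h (off_outside fr)).
by rewrite /positive !vel.
Qed.

(** Gluing: [c] is kept outside and each strand receives the step function with the same end colors
    and the new middle color. The delicate points are the ends, where the two definitions meet. *)
Lemma coloring_extend c (v1 : I -> X) : coloring D c ->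
  local_coloring J D' t1' t2' (fun k => c true ((J k).1, (J k).2.1)) v1
    (fun k => c true ((J k).1, (J k).2.2)) ->
  exists2 c', coloring D' c' & forall b p, outside J p -> c b p = c' b p.
Proof.
move=> hc hv.
pose w k := step (t1' k) (t2' k) (c true ((J k).1, (J k).2.1)) (v1 k)
  (c true ((J k).1, (J k).2.2)).
(* The value inside is well defined because a point lies on at most one strand, at a single
   parameter of it. *)
have /choice[c2 hc2] : forall bp : bool * circle_point R n, exists v,
    (outside J bp.2 -> v = c bp.1 bp.2) /\
    (forall k u, (J k).2.1 < u < (J k).2.2 -> same_point bp.2 ((J k).1, u) ->
      v = w k bp.1 u).
  move=> [b p] /=; have [op|nop] := pselect (outside J p).
    exists (c b p); split=> // k u hu h; case: (op k).
    by apply: inside_strand_same (same_sym h) _; exact: strand_inside.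
  have [k /inside_strand_point[u hu h]] : exists k, inside_strand (J k) p.
    by apply: contrapT => h; apply: nop => k hk; apply: h; exists k.
  exists (w k b u); split=> // l u' hu' h'.
  have hu1 : (J k).2.1 <= u <= (J k).2.2 by lra.
  have hu1' : (J l).2.1 <= u' <= (J l).2.2 by lra.
  by have [-> ->] := param_uniq J_proper J_disjoint hu1 hu1' (same_trans (same_sym h) h').
pose c' b p := c2 (b, p).
have c'out b p : outside J p -> c' b p = c b p by have [h _] := hc2 (b, p).
have c'in b p k u : (J k).2.1 < u < (J k).2.2 -> same_point p ((J k).1, u) ->
  c' b p = w k b u by have [_ h] := hc2 (b, p); exact: h.
have out_same p q : same_point p q -> outside J p -> outside J q.
  by move=> pq op k /(inside_strand_same (same_sym pq))/op.
have inP p : outside J p \/ exists k u, (J k).2.1 < u < (J k).2.2 /\ same_point p ((J k).1, u).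
  have [op|nop] := pselect (outside J p); first by left.
  right; have [k /inside_strand_point[u hu h]] : exists k, inside_strand (J k) p.
    by apply: contrapT => h; apply: nop => k hk; apply: h; exists k.
  by exists k, u.
have order := tangle_order hD'.
have at_slot b k e : c' b (slot J t1' t2' k e) =
    if e then if b then c true ((J k).1, (J k).2.2) else v1 k
    else if b then v1 k else c true ((J k).1, (J k).2.1).
  have [_ r2 _] := order k.
  rewrite (c'in b _ k (if e then t2' k else t1' k)) ?(slot_range hD')//.
    by rewrite /w step_slot.
  exact: same_refl.
exists c'; last by move=> b p op; rewrite c'out.
split.
- move=> b p q pq; have [op|[k [u [hu h]]]] := inP p.
    rewrite !c'out//; [exact: (coloring_same hc)|exact: out_same op].
  by rewrite (c'in _ _ _ _ hu h) (c'in _ _ _ _ hu (same_trans (same_sym pq) h)).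
- move=> p np; have [op|[k [u [hu h]]]] := inP p.
    by rewrite !c'out//; apply: (coloring_uncut hc) => /(cut_agree op).
  rewrite !(c'in _ _ _ _ hu h) /w.
  have slot_uncut e : u = (if e then t2' k else t1' k) -> ~ cut_point D' (slot J t1' t2' k e).
    by rewrite /slot => <-; move/(cut_same (same_sym h)).
  have [u1|u1] := eqVneq u (t1' k).
    have := local_uncut hv (slot_uncut false u1).
    by have [_ r2 _] := order k; rewrite u1 !(step_slot _ _ _ _ false r2).
  have [u2|u2] := eqVneq u (t2' k); last exact: step_uncut.
  have := local_uncut hv (slot_uncut true u2).
  by have [_ r2 _] := order k; rewrite u2 !(step_slot _ _ _ _ true r2).
- move=> b p; have [op|[k [u [hu h]]]] := inP p; last first.
    have [_ r2 _] := order k; case: h => e [m em].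
    have [d d0 hd] := step_near (c true ((J k).1, (J k).2.1)) (v1 k)
      (c true ((J k).1, (J k).2.2)) b u r2.
    pose d' := Num.min d (Num.min (u - (J k).2.1) ((J k).2.2 - u)).
    have [d1 d2 d3 d4] : [/\ 0 < d', d' <= d, d' <= u - (J k).2.1 & d' <= (J k).2.2 - u].
      rewrite /d' !lt_min !ge_min !lexx !orbT d0 !subr_gt0; split=> //; lra.
    exists d' => // x hx b'.
    rewrite (c'in b' _ k (x - m%:~R)); first last.
    + by split=> //; exists m; rewrite /= subrK.
    + move: hx em; rewrite /on_side /=; case: (b); lra.
    rewrite (c'in b p k u hu); last by split=> //; exists m.
    apply: hd; move: hx em; rewrite /on_side /=; case: (b); lra.
  have [h|[k h]] := outside_near J_proper b op.
    apply: near_side_mono (near_sideI h (coloring_near hc b p)) => u [ou hu] b'.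
    by rewrite !c'out.
  (* Here [p] is an end of strand [k] seen from the inside: up to the nearest slot the step function
     keeps the color that [c] has at this end. *)
  have [r1 r2 r3] := order k; have hk := uncut_end J_proper J_disjoint hD (k := k).
  rewrite c'out// (coloring_same hc _ h).
  case: h => e [m em].
  exists (if b then t1' k - (J k).2.1 else (J k).2.2 - t2' k).
    by case: (b); lra.
  move=> u hu b'; rewrite (c'in b' _ k (u - m%:~R)); first last.
  + by split=> //; exists m; rewrite /= subrK.
  + move: hu em; rewrite /on_side /=; case: (b); lra.
  move: hu em; rewrite /w /on_side /=; case: (b) => hu em.
    by rewrite step_lt//; lra.
  rewrite step_gt//; last by lra.
  by rewrite -(coloring_uncut hc)//; apply: hk; right.
(* By [tangle_closed] both points of a crossing are off the strands, where the diagrams agree, or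
   both are slots, where [hv] applies. *)
- move=> p q h; have [op|[k [u [hu hp]]]] := inP p.
    have fp : off J p by apply: (cut_outside_off hD') => //; exists q; left.
    have fq : off J q by apply: (above_off hD') fp; left.
    have oq := off_outside fq.
    rewrite !c'out// (asbool_equiv_eq (positive_agree fp fq)).
    by apply: (coloring_crossing hc); exact: (DD'.2 p q op oq).1.
  have pk : on_strand (J k) p.
    by apply: on_strand_same (same_sym hp) _; apply: strand_on; lra.
  have [l ql] : exists l, on_strand (J l) q by apply: (tangle_closed hD') pk; left.
  have [e {}hp] := tangle_cut hD' (ex_intro _ q (or_introl h)) pk.
  have [e' hq] := tangle_cut hD' (ex_intro _ p (or_intror h)) ql.
  have := local_crossing hv (above_same hp hq h).
  rewrite /positive -(velocity_same D' hp) -(velocity_same D' hq).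
  rewrite /crossing_type hp.1 hq.1 /=.
  have same b r s : same_point r s -> c' b r = c' b s.
    move=> rs; have [orr|[k' [u' [hu' h']]]] := inP r.
      rewrite !c'out//; [exact: (coloring_same hc)|exact: out_same orr].
    by rewrite (c'in _ _ _ _ hu' h') (c'in _ _ _ _ hu' (same_trans (same_sym rs) h')).
  rewrite !(same _ _ _ hp) !(same _ _ _ hq) !at_slot /color_before /color_after.
  by case: (e) (e') => [] [].
Qed.

Lemma coloring_extend_uniq c1 c2 : coloring D' c1 -> coloring D' c2 ->
  (forall b p, outside J p -> c1 b p = c2 b p) ->
  (forall k, c1 true ((J k).1, t1' k) = c2 true ((J k).1, t1' k)) -> c1 = c2.
Proof.
move=> h1 h2 out mid; apply/funext => b; apply/funext => p.
have [op|nop] := pselect (outside J p); first exact: out.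
have [k /inside_strand_point[u hu h]] : exists k, inside_strand (J k) p.
  by apply: contrapT => h; apply: nop => k hk; apply: h; exists k.
rewrite (coloring_same h1 b h) (coloring_same h2 b h).
have hu' : (J k).2.1 <= u <= (J k).2.2 by lra.
rewrite (coloring_step J_proper J_disjoint hD' b h1 hu').
rewrite (coloring_step J_proper J_disjoint hD' b h2 hu').
by rewrite mid !out//; apply: (outside_end J_proper J_disjoint); [right|left].
Qed.

End Extension.

Lemma agree_outside_sym D D' : agree_outside D D' -> agree_outside D' D.
Proof.
by move=> [h1 h2]; split=> [p /h1//|p q op oq]; apply: iff_sym; exact: h2.
Qed.

(** The topology ends here: it remains to solve for [v1] on each side with the same end colors, and
    to see that these determine [v1]. *)
Lemma tangle_move_quiver (S : set (mcEnd X)) (D D' : diagram R n)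
    (t1 t2 t1' t2' : I -> R) :
  tangle J D t1 t2 -> tangle J D' t1' t2' -> agree_outside D D' ->
  (forall v0 v1 v2 : I -> X, local_coloring J D t1 t2 v0 v1 v2 ->
    exists v1', local_coloring J D' t1' t2' v0 v1' v2) ->
  (forall v0 v1 v2 : I -> X, local_coloring J D' t1' t2' v0 v1 v2 ->
    exists v1', local_coloring J D t1 t2 v0 v1' v2) ->
  (forall v0 v1 v1' v2 : I -> X, local_coloring J D t1 t2 v0 v1 v2 ->
    local_coloring J D t1 t2 v0 v1' v2 -> v1 =1 v1') ->
  (forall v0 v1 v1' v2 : I -> X, local_coloring J D' t1' t2' v0 v1 v2 ->
    local_coloring J D' t1' t2' v0 v1' v2 -> v1 =1 v1') ->
  quiver_iso (coloring_quiver S (existT _ n D)) (coloring_quiver S (existT _ n D')).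
Proof.
move=> hD hD' DD' ex ex' un un'; have D'D := agree_outside_sym DD'.
apply: (@quiver_iso_colorings _ _ _ _ _ _ _
  (fun c c' => forall b p, outside J p -> c b p = c' b p)).
- move=> c hc; have [v1 h] := ex _ _ _ (coloring_local J_proper J_disjoint hD hc).
  exact: (coloring_extend hD hD' DD' hc h).
- move=> c hc; have [v1 h] := ex' _ _ _ (coloring_local J_proper J_disjoint hD' hc).
  have [c' hc' e] := coloring_extend hD' hD D'D hc h.
  by exists c' => // b p /e.
- move=> c c1 c2 _ h1 h2 e1 e2.
  have e b p : outside J p -> c1 b p = c2 b p by move=> op; rewrite -e1 ?e2.
  apply: (coloring_extend_uniq hD' h1 h2 e).
  apply: un' (coloring_local J_proper J_disjoint hD' h1) _.
  have := coloring_local J_proper J_disjoint hD' h2.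
  congr local_coloring; apply/funext => k; rewrite e//;
    by apply: (outside_end J_proper J_disjoint); auto.
- move=> c c1 c2 _ h1 h2 e1 e2.
  have e b p : outside J p -> c1 b p = c2 b p by move=> op; rewrite e1 ?e2.
  apply: (coloring_extend_uniq hD h1 h2 e).
  apply: un (coloring_local J_proper J_disjoint hD h1) _.
  have := coloring_local J_proper J_disjoint hD h2.
  congr local_coloring; apply/funext => k; rewrite e//;
    by apply: (outside_end J_proper J_disjoint); auto.
- by move=> phi c c' h b p op; rewrite h.
Qed.

End TangleMove.

(** * Reidemeister moves *)

Section UncutTangles.
Local Open Scope ring_scope.
Variables (R : realType) (X : mcBiquandleType) (n : nat) (I : finType).
Variables (J : I -> strand R n) (D : diagram R n) (t1 t2 : I -> R).
Hypothesis order : forall k, [/\ (J k).2.1 < t1 k, t1 k < t2 k & t2 k < (J k).2.2].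
Hypothesis uncut : forall p k, on_strand (J k) p -> ~ cut_point D p.

Lemma uncut_tangle : tangle J D t1 t2.
Proof.
split=> // [p k cp /uncut//|p q k h /uncut[]].
by exists q.
Qed.

Lemma uncut_local_coloring (v0 v1 v2 : I -> X) :
  local_coloring J D t1 t2 v0 v1 v2 <-> forall k, v0 k = v1 k /\ v1 k = v2 k.
Proof.
have slot_uncut k e : ~ cut_point D (slot J t1 t2 k e).
  apply: (@uncut _ k); apply: strand_on; have [r1 r2 r3] := order k.
  by case: e; lra.
split=> [[h _] k|h].
  by have := h k false (slot_uncut _ _); have := h k true (slot_uncut _ _).
split=> [k e _|k e l e' h']; first by have [h1 h2] := h k; case: e => /=; rewrite ?h1 ?h2.
by case: (slot_uncut k e); exists (slot J t1 t2 l e'); left.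
Qed.

End UncutTangles.

Section Kinks.
Variables (X : mcBiquandleType) (fX : finite_set [set: X]).
Implicit Types (v : X) (e pos : bool).

(* The overstrand is met at slot [e], hence the understrand at slot [~~ e]. *)
Definition kink pos e v0 v1 v2 : Prop :=
  crossing_colors pos single (if ~~ e then v1 else v0) (if ~~ e then v2 else v1)
    (if e then v1 else v0) (if e then v2 else v1).

(** The inner arc meets the crossing twice in the same role. If it is both inputs, [over_diag]
    equates the ends. If it is both outputs, it is a diagonal value by [diag_surj], and injectivity
    of the switch makes the two inputs equal. *)
Lemma kinkP pos e v0 v1 v2 : kink pos e v0 v1 v2 <->
  v0 = v2 /\ if pos (+) e then utri single v1 v1 = v0 else utri single v0 v0 = v1.
Proof.
have diag (x y z : X) : z = utri single x y -> z = otri single y x -> x = y.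
  have [w <-] := diag_surj fX z => h1 h2.
  by have [||-> ->] := @switch_inj X single x w y w; rewrite ?over_diag.
rewrite /kink /crossing_colors /xing; case: pos e => [] [] /=;
  split=> [[h1 h2]|[-> <-]]; rewrite ?over_diag //.
- by have e := diag _ _ _ h1 h2; rewrite h1 e.
- by rewrite h2 h1 over_diag.
- by rewrite h1 h2 over_diag.
- by have e := diag _ _ _ h1 h2; rewrite h1 e.
Qed.

Lemma kink_ex pos e v : exists v1, kink pos e v v1 v.
Proof.
have [w hw] := diag_surj fX v.
by exists (if pos (+) e then w else utri single v v); apply/kinkP; case: (pos (+) e).
Qed.

Lemma kink_uniq pos e v0 v1 v1' v2 v2' :
  kink pos e v0 v1 v2 -> kink pos e v0 v1' v2' -> v1 = v1'.
Proof.
move=> /kinkP[_ h] /kinkP[_]; move: h; case: (pos (+) e) => <- //.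
by move/diag_inj.
Qed.
End Kinks.

Section SmallMoves.
Local Open Scope ring_scope.
Variables (R : realType) (X : mcBiquandleType) (S : set (mcEnd X)) (n : nat).
Variables D D' : diagram R n.

(** A strand without cut points may take any two inner parameters as slots. *)
Lemma strand_thirds (J : strand R n) : proper_strand J ->
  let t k := J.2.1 + k * (J.2.2 - J.2.1) / 3 in
  [/\ J.2.1 < t 1, t 1 < t 2 & t 2 < J.2.2].
Proof. by rewrite /proper_strand /= => h; split; lra. Qed.

Lemma detour_quiver : detour D D' ->
  quiver_iso (coloring_quiver S (existT _ n D)) (coloring_quiver S (existT _ n D')).
Proof.
move=> [J [pJ [a1 a2] nc]]; pose t k (_ : unit) := J.2.1 + k * (J.2.2 - J.2.1) / 3.
have order (k : unit) : [/\ J.2.1 < t 1 k, t 1 k < t 2 k & t 2 k < J.2.2] := strand_thirds pJ.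
have ncD p (_ : unit) : on_strand J p -> ~ cut_point D p by move=> /nc[].
have ncD' p (_ : unit) : on_strand J p -> ~ cut_point D' p by move=> /nc[].
have lc := uncut_local_coloring (J := fun=> J) (X := X) order ncD.
have lc' := uncut_local_coloring (J := fun=> J) (X := X) order ncD'.
apply: (@tangle_move_quiver _ X _ unit (fun=> J) _ _ S _ _ (t 1) (t 2) (t 1) (t 2)).
- by [].
- by move=> [] [].
- exact: uncut_tangle.
- exact: uncut_tangle.
- split=> [p op|p q op oq]; first exact: a1 (op tt).
  exact: a2 (op tt) (oq tt).
- by move=> v0 v1 v2 /lc h; exists v1; apply/lc'.
- by move=> v0 v1 v2 /lc' h; exists v1; apply/lc.
- by move=> v0 v1 v1' v2 /lc h /lc h' k; rewrite -(h k).1 -(h' k).1.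
- by move=> v0 v1 v1' v2 /lc' h /lc' h' k; rewrite -(h k).1 -(h' k).1.
Qed.

Lemma near_side_nbhs b (x : R) (P : R -> Prop) :
  (\forall u \near x, P u) -> near_side b x P.
Proof.
move=> /nbhs_ballP[e /= e0 h]; exists e => // u hu; apply: h.
by rewrite /ball /= ltr_distlC; move: hu; rewrite /on_side; case: (b); lra.
Qed.

Lemma curve_continuous (E : diagram R n) i : continuous (curve E i).
Proof. by move=> t; apply/differentiable_continuous/derivable1_diffP/curve_derivable. Qed.

Lemma limit_norm_le1 b (f : R -> R) x : {for x, continuous f} ->
  near_side b x (fun u => `|f u| < 1) -> `|f x| <= 1.
Proof.
move=> cf h; rewrite leNgt; apply/negP => fx.
have cn : (fun u => `|f u|) @ x --> `|f x| by exact: cvg_norm.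
have /(near_side_nbhs b) h' : \forall u \near x, 1 < `|f u| by exact: cvgr_gt cn _ fx.
by have [u [h1 h2]] := near_side_ex (near_sideI h h'); lra.
Qed.

(** The ends of the strand are limits of points of the open box; the closed box is the one that
    [outside_box] keeps free of the rest of the diagram. *)
Lemma strand_box (E : diagram R n) (J : strand R n) : proper_strand J ->
  (forall p, inside_strand J p -> open_box (curve E p.1 p.2)) ->
  forall p, on_strand J p -> box (curve E p.1 p.2).
Proof.
rewrite /proper_strand => pJ hin.
have key b u : near_side b u (fun v => inside_strand J (J.1, v)) -> box (curve E J.1 u).
  move=> h; have cE := @curve_continuous E J.1 u; split.
    apply: (@limit_norm_le1 b (fun v => (curve E J.1 v).1)).
      exact: (cvg_comp _ _ cE cvg_fst).
    by apply: near_side_mono h => v /hin[].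
  apply: (@limit_norm_le1 b (fun v => (curve E J.1 v).2)).
    exact: (cvg_comp _ _ cE cvg_snd).
  by apply: near_side_mono h => v /hin[].
move=> p /on_strand_point[u hu [e [k h]]].
rewrite e h curve_shift /=; have [ua|ua] := ltP u J.2.2.
  apply: (key true); exists (J.2.2 - u); first by lra.
  by move=> v; rewrite /on_side => hv; apply: strand_inside; lra.
apply: (key false); exists (u - J.2.1); first by lra.
by move=> v; rewrite /on_side => hv; apply: strand_inside; lra.
Qed.

(** The two points of a crossing have the same image, which lies in the box exactly when they are on
    the strands. *)
Lemma box_closed (I : Type) (J : I -> strand R n) (E : diagram R n) :
  (forall p, (forall k, ~ on_strand (J k) p) -> ~ box (curve E p.1 p.2)) ->
  (forall k p, on_strand (J k) p -> box (curve E p.1 p.2)) ->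
  forall p q k, above E p q \/ above E q p ->
    on_strand (J k) p -> exists l, on_strand (J l) q.
Proof.
move=> hout hin p q k h pk; apply: contrapT => nq.
apply: (hout q) => [l ql|]; first by apply: nq; exists l.
suff <- : curve E p.1 p.2 = curve E q.1 q.2 by exact: hin pk.
by case: h => /above_crossing[].
Qed.

Lemma reidemeister1_quiver (fX : finite_set [set: X]) : reidemeister1 D D' ->
  quiver_iso (coloring_quiver S (existT _ n D)) (coloring_quiver S (existT _ n D')).
Proof.
move=> [J [pJ [a1 a2] hbox hin [nocross [p0 [q0 [ip iq ab hcross]]]]]].
have hout' p : ~ on_strand J p -> ~ box (curve D' p.1 p.2).
  by move=> h; rewrite a1; [exact: hbox|move=> /on_inside/h].
have [[u hu hp] [v hv hq]] := (inside_strand_point ip, inside_strand_point iq).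
have uv : u != v.
  apply/eqP => e; subst v; have [ns _] := above_crossing ab; apply: ns.
  exact: same_trans hp (same_sym hq).
(* The slot of the overstrand: [true] when the arc passes over on its second visit to the
   crossing. *)
pose e0 := v < u.
pose t1 (_ : unit) := Num.min u v; pose t2 (_ : unit) := Num.max u v.
have order (k : unit) : [/\ J.2.1 < t1 k, t1 k < t2 k & t2 k < J.2.2].
  rewrite /t1 /t2; move: uv; rewrite neq_lt.
  by case: (ltP u v) => ? /orP[?|?]; split; lra.
pose sl := slot (fun=> J) t1 t2 tt.
have sp : same_point p0 (sl e0).
  by rewrite /sl /slot /e0 /t1 /t2; case: ltP => _.
have sq : same_point q0 (sl (~~ e0)).
  by rewrite /sl /slot /e0 /t1 /t2; case: ltP => _.
have r (e : bool) : J.2.1 <= (if e then t2 tt else t1 tt) <= J.2.2.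
  by have [r1 r2 r3] := order tt; case: e; lra.
have slot_inj e e' : same_point (sl e) (sl e') -> e = e'.
  move/(strand_param_uniq pJ (r e) (r e')); have [_ r2 _] := order tt.
  by case: e e' => [] [] // h; move: r2; rewrite h ltxx.
have ncD p (_ : unit) : on_strand J p -> ~ cut_point D p.
  move=> hp' [q h]; have [_ hq'] := @box_closed unit (fun=> J) D
    (fun p np => hbox p (np tt)) (fun=> strand_box pJ (fun p h => (hin p h).1)) p q tt h hp'.
  by case: h => /above_crossing; apply: nocross.
have closed' := @box_closed unit (fun=> J) D' (fun p np => hout' p (np tt))
  (fun=> strand_box pJ (fun p h => (hin p h).2)).
have above_slots p q : above D' p q -> on_strand J p \/ on_strand J q ->
    same_point p (sl e0) /\ same_point q (sl (~~ e0)).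
  move=> h hpq; have [hp' hq'] : on_strand J p /\ on_strand J q.
    case: hpq => h'; split=> //.
      by have [_] := closed' p q tt (or_introl h) h'.
    by have [_] := closed' q p tt (or_intror h) h'.
  case: (hcross p q hp' hq' (above_crossing h)) => -[e1 e2].
    by split; [exact: same_trans e1 sp|exact: same_trans e2 sq].
  by case: (above_asym (above_same e1 e2 h) ab).
have tD' : tangle (fun=> J) D' t1 t2.
  split=> // p k [q [h|h]] hp'.
  - by exists e0; have [] := above_slots _ _ h (or_introl hp').
  - by exists (~~ e0); have [] := above_slots _ _ h (or_intror hp').
pose pos := `[< positive D' (sl e0) (sl (~~ e0)) >].
have ab' : above D' (sl e0) (sl (~~ e0)) := above_same sp sq ab.
have lc := uncut_local_coloring (J := fun=> J) (X := X) order ncD.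
have lc' (v0 v1 v2 : unit -> X) : local_coloring (fun=> J) D' t1 t2 v0 v1 v2 <->
    kink pos e0 (v0 tt) (v1 tt) (v2 tt).
  split=> [[_ h]|h].
    by have := h tt e0 tt (~~ e0) ab'; rewrite /kink eqxx.
  split=> [[] e nc|[] e [] e' h'].
    case: nc; case: (eqVneq e e0) => [->|ne]; first by exists (sl (~~ e0)); left.
    by exists (sl e0); right; have -> : e = ~~ e0 by case: (e) (e0) ne => [] [].
  have [/slot_inj e1 /slot_inj e2] := above_slots _ _ h' (or_introl (strand_on (r e))).
  by rewrite eqxx e1 e2.
apply: (@tangle_move_quiver _ X _ unit (fun=> J) _ _ S _ _ t1 t2 t1 t2).
- by [].
- by move=> [] [].
- exact: uncut_tangle.
- exact: tD'.
- split=> [p op|p q op oq]; first exact: a1 (op tt).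
  exact: a2 (op tt) (oq tt).
- move=> v0 v1 v2 /lc h; have [w hw] := kink_ex fX pos e0 (v0 tt).
  by exists (fun=> w); apply/lc'; rewrite -(h tt).2 -(h tt).1.
- move=> v0 v1 v2 /lc'/(kinkP fX)[h _]; exists v0; apply/lc => -[].
  by split.
- by move=> v0 v1 v1' v2 /lc h /lc h' k; rewrite -(h k).1 -(h' k).1.
- by move=> v0 v1 v1' v2 /lc' h /lc' h' []; exact: kink_uniq h h'.
Qed.

End SmallMoves.

(** * Strands that are graphs over an interval *)

Section GraphStrands.
Local Open Scope ring_scope.
Variables (R : realType) (n : nat).

Section Abscissa.
Variables (J : strand R n) (d : bool).
Hypothesis pJ : proper_strand J.

Definition xparam (x : R) : R := J.2.1 + (J.2.2 - J.2.1) / 2 * ((-1) ^+ d * x + 1).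
Definition xcoord (t : R) : R := (-1) ^+ d * (2 * (t - J.2.1) / (J.2.2 - J.2.1) - 1).

Let len_gt0 : 0 < J.2.2 - J.2.1.
Proof. by move: pJ; rewrite /proper_strand; lra. Qed.

Lemma xparamK : cancel xparam xcoord.
Proof.
move=> x; rewrite /xcoord /xparam; have := len_gt0.
have : (-1) ^+ d * (-1) ^+ d = 1 :> R by rewrite -expr2 sqrr_sign.
move: ((-1) ^+ d) => s hs h; have h0 : J.2.2 - J.2.1 != 0 by rewrite gt_eqF.
transitivity (s * s * x); last by rewrite hs mul1r.
by field.
Qed.

Lemma xcoordK : cancel xcoord xparam.
Proof.
move=> t; rewrite /xcoord /xparam; have := len_gt0 => h.
have h0 : J.2.2 - J.2.1 != 0 by rewrite gt_eqF.
rewrite mulrA -expr2 sqrr_sign mul1r; by field.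
Qed.

Lemma xparam_range x : -1 <= x <= 1 -> J.2.1 <= xparam x <= J.2.2.
Proof.
by rewrite /xparam; have := len_gt0; case: (d) => /=; rewrite ?expr0 ?expr1 => h hx; nra.
Qed.

Lemma xparam_inside x : -1 < x < 1 -> J.2.1 < xparam x < J.2.2.
Proof.
by rewrite /xparam; have := len_gt0; case: (d) => /=; rewrite ?expr0 ?expr1 => h hx; nra.
Qed.

Lemma xcoord_range t : J.2.1 <= t <= J.2.2 -> -1 <= xcoord t <= 1.
Proof.
move=> ht; have h := len_gt0; rewrite /xcoord.
have : 0 <= (t - J.2.1) / (J.2.2 - J.2.1) <= 1.
  by rewrite divr_ge0 ?ler_pdivrMr//; lra.
by rewrite -mulrA; case: (d) => /=; rewrite ?expr0 ?expr1; lra.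
Qed.

Lemma xparam_lt x y : x < y -> if d then xparam y < xparam x else xparam x < xparam y.
Proof.
by rewrite /xparam; have := len_gt0; case: (d) => /=; rewrite ?expr0 ?expr1 => h hx; nra.
Qed.

Definition xpoint (x : R) : circle_point R n := (J.1, xparam x).

Lemma xpoint_on x : -1 <= x <= 1 -> on_strand J (xpoint x).
Proof. by move=> /xparam_range; exact: strand_on. Qed.

Lemma on_strand_xpoint p : on_strand J p ->
  exists2 x, -1 <= x <= 1 & same_point p (xpoint x).
Proof.
move=> /on_strand_point[u hu h]; exists (xcoord u); first exact: xcoord_range.
by rewrite /xpoint xcoordK.
Qed.

Lemma derive_xparam (x : R) : is_derive x (1 : R) xparam ((J.2.2 - J.2.1) / 2 * (-1) ^+ d).
Proof.
rewrite /xparam; apply: is_derive_eq; rewrite /GRing.scale /=.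
by rewrite add0r mul1r mulr1 addr0.
Qed.

Variables (D : diagram R n) (f : R -> R).
Hypothesis Jf : graph_strand D J d f.

Lemma graph_curve x : -1 <= x <= 1 -> curve D J.1 (xparam x) = (x, f x).
Proof.
by move=> /xparam_range /Jf [] /=; rewrite -/(xcoord _) xparamK.
Qed.

Lemma graph_box p : on_strand J p -> box (curve D p.1 p.2).
Proof.
move=> /on_strand_xpoint[x hx [e [k h]]]; rewrite e h curve_shift graph_curve//.
have [_] := Jf (xparam_range hx); rewrite -/(xcoord _) xparamK => fx.
by split=> /=; [rewrite ler_norml|exact: ltW].
Qed.

(** [f] is an arbitrary function, so the slope is read off the curve parametrized by abscissa. The
    scalar is the derivative of [xparam], whose sign records the direction of the strand. *)
Lemma graph_velocity x : -1 < x < 1 -> exists a,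
  [/\ derivable (fun y => (curve D J.1 (xparam y)).2) x 1,
     derive1 (fun y => (curve D J.1 (xparam y)).2) x = a &
     (J.2.2 - J.2.1) / 2 * (-1) ^+ d *: velocity (curve D) (xpoint x) = (1, a)].
Proof.
move=> hx; pose F y := curve D J.1 (xparam y).
have [dx ex] := derive_xparam x.
have Fd : derive1 F x = (J.2.2 - J.2.1) / 2 * (-1) ^+ d *: velocity (curve D) (xpoint x).
  by rewrite (derive1_comp_real dx (@curve_derivable _ _ D J.1 _)) derive1E ex.
have dF : differentiable F x.
  apply: (@differentiable_comp _ _ _ _ xparam (curve D J.1)).
    exact/derivable1_diffP.
  exact/derivable1_diffP/curve_derivable.
have D1 : 'd (fst : R * R -> R) (F x) = fst :> (R * R -> R).
  by apply: diff_lin => y; exact: cvg_fst.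
have D2 : 'd (snd : R * R -> R) (F x) = snd :> (R * R -> R).
  by apply: diff_lin => y; exact: cvg_snd.
have d1 : differentiable (fst : R * R -> R) (F x).
  by apply: linear_differentiable => y; exact: cvg_fst.
have d2 : differentiable (snd : R * R -> R) (F x).
  by apply: linear_differentiable => y; exact: cvg_snd.
have dF1 := (derivable1_diffP F x).2 dF.
exists (derive1 F x).2; split.
- apply/derivable1_diffP; exact: (differentiable_comp dF d2).
- by rewrite (derive1_comp_diff dF1 d2) D2.
- rewrite -Fd [LHS]surjective_pairing; congr pair.
  have -> : (derive1 F x).1 = derive1 (fun y => (F y).1) x.
    by rewrite (derive1_comp_diff dF1 d1) D1.
  (* Near [x] the first coordinate of the curve is the abscissa itself, with derivative 1. *)
  rewrite -(derive1_id x) !derive1E; apply: near_eq_derive.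
  apply/nbhs_ballP; exists (Num.min (x + 1) (1 - x)) => /= [|y].
    by rewrite lt_min; lra.
  rewrite /ball /= lt_min !ltr_distlC => hy; rewrite /F graph_curve//; lra.
Qed.

End Abscissa.

Lemma sign_change (g : R -> R) c : derivable g c 1 ->
  near_side false c (fun x => g x < 0) -> near_side true c (fun x => 0 < g x) ->
  g c = 0 /\ 0 <= derive1 g c.
Proof.
move=> dg hl hr; have cg : g @ c --> g c.
  exact/differentiable_continuous/derivable1_diffP.
have g0 : g c = 0.
  apply/eqP; rewrite eq_le !leNgt; apply/andP; split; apply/negP => h.
    have /(near_side_nbhs false) h' : \forall x \near c, 0 < g x by exact: cvgr_gt cg _ h.
    by have [x [h1 h2]] := near_side_ex (near_sideI hl h'); lra.
  have /(near_side_nbhs true) h' : \forall x \near c, g x < 0 by exact: cvgr_lt cg _ h.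
  by have [x [h1 h2]] := near_side_ex (near_sideI hr h'); lra.
split=> //; rewrite derive1E; apply: limr_ge => //.
have [e e0 he] := hl; have [e' e'0 he'] := hr.
apply/nbhs_ballP; exists (Num.min e e') => /=; first by rewrite lt_min e0.
move=> u; rewrite /ball /= sub0r normrN lt_min !ltr_norml => hu u0.
rewrite g0 subr0 /GRing.scale /= mulr1.
have [un|up|] := ltgtP u 0; last by move/eqP: u0.
  rewrite nmulr_rge0 ?invr_lt0//; apply: ltW; apply: he; rewrite /on_side; lra.
rewrite pmulr_rge0 ?invr_gt0//; apply: ltW; apply: he'; rewrite /on_side; lra.
Qed.

End GraphStrands.

Section GraphCrossings.
Local Open Scope ring_scope.
Variables (R : realType) (n : nat) (D : diagram R n).

Lemma det2C (v w : R * R) : det2 w v = - det2 v w.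
Proof. by rewrite /det2; ring. Qed.

Lemma near_side_open b (c : R) (P : R -> Prop) : -1 < c < 1 ->
  near_side b c (fun x => -1 < x < 1 -> P x) -> near_side b c P.
Proof.
move=> hc h; have hb : near_side b c (fun x => -1 < x < 1).
  exists (Num.min (c + 1) (1 - c)); first by rewrite lt_min; lra.
  move=> x; rewrite /on_side; have [h1 h2] : Num.min (c + 1) (1 - c) <= c + 1 /\
    Num.min (c + 1) (1 - c) <= 1 - c by rewrite !ge_min !lexx orbT.
  by case: (b); lra.
by apply: near_side_mono (near_sideI h hb) => x [h1 /h1].
Qed.

(** The slopes satisfy [b <= a] by [sign_change], so the determinant [b - a] of [(1, a)] and
    [(1, b)] is at most 0. Transversality makes the determinant of the velocities nonzero, and the
    two directions turn this into its sign. *)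
Lemma graph_crossing (J K : strand R n) (d e : bool) (f g : R -> R) c :
  proper_strand J -> proper_strand K -> disjoint_strands J K ->
  graph_strand D J d f -> graph_strand D K e g -> -1 < c < 1 ->
  near_side false c (fun x => -1 < x < 1 -> f x < g x) ->
  near_side true c (fun x => -1 < x < 1 -> g x < f x) ->
  [/\ crossing (curve D) (xpoint J d c) (xpoint K e c),
      `[< positive D (xpoint J d c) (xpoint K e c) >] = d (+) e &
      `[< positive D (xpoint K e c) (xpoint J d c) >] = ~~ (d (+) e)].
Proof.
move=> pJ pK dJK Jf Kg hc hl hr.
have hc' : -1 <= c <= 1 by lra.
have [a [dF eF vF]] := graph_velocity pJ Jf hc.
have [b [dG eG vG]] := graph_velocity pK Kg hc.
set F := (fun y => _) in dF eF; set G := (fun y => _) in dG eG.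
have FE x : -1 < x < 1 -> F x = f x by move=> hx; rewrite /F (graph_curve pJ Jf) //; lra.
have GE x : -1 < x < 1 -> G x = g x by move=> hx; rewrite /G (graph_curve pK Kg) //; lra.
have [||FG0 ab] := @sign_change R (F - G) c (derivableB dF dG).
- apply: near_side_open => //; apply: near_side_mono hl => x h hx.
  by rewrite /= -[_ < _]/(F x - G x < 0) FE// GE// subr_lt0 h.
- apply: near_side_open => //; apply: near_side_mono hr => x h hx.
  by rewrite /= -[_ < _]/(0 < F x - G x) FE// GE// subr_gt0 h.
have fg : f c = g c.
  by apply/eqP; rewrite -subr_eq0 -FE// -GE//; apply/eqP; exact: FG0.
have cr : crossing (curve D) (xpoint J d c) (xpoint K e c).
  split; last by rewrite /= (graph_curve pJ Jf)// (graph_curve pK Kg)// fg.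
  move=> h; have : (on_strand J `&` on_strand K) (xpoint J d c).
    split; first exact: xpoint_on.
    by apply: on_strand_same (same_sym h) _; exact: xpoint_on.
  by rewrite dJK.
have det0 := curve_transverse cr.
move: ab; rewrite derive1E deriveB// -!derive1E eF eG => ab.
have := det2Z ((J.2.2 - J.2.1) / 2 * (-1) ^+ d) ((K.2.2 - K.2.1) / 2 * (-1) ^+ e)
  (velocity (curve D) (xpoint J d c)) (velocity (curve D) (xpoint K e c)).
rewrite vF vG /positive (det2C (velocity (curve D) (xpoint J d c))).
move: det0 => /eqP; set z := det2 (velocity _ _) _ => z0 hz.
have {hz ab} : (J.2.2 - J.2.1) / 2 * (-1) ^+ d * ((K.2.2 - K.2.1) / 2 * (-1) ^+ e) * z <= 0.
  by rewrite -hz /det2 /=; lra.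
have lJ : 0 < (J.2.2 - J.2.1) / 2 by move: pJ; rewrite /proper_strand; lra.
have lK : 0 < (K.2.2 - K.2.1) / 2 by move: pK; rewrite /proper_strand; lra.
move: ((J.2.2 - J.2.1) / 2) ((K.2.2 - K.2.1) / 2) lJ lK => mJ mK lJ lK.
rewrite mulrACA -[X in X <= _ -> _]mulrA pmulr_rle0; last exact: mulr_gt0.
move=> hz; have sz : (0 < z) = d (+) e.
  move: hz z0; rewrite neq_lt; case: (d); case: (e); case: (ltP 0 z) => hz;
    rewrite /= ?expr0 ?expr1 => h /orP[] z0 //; exfalso; lra.
split=> //; rewrite asboolb// oppr_gt0 -sz.
by rewrite -leNgt le_eqVlt (negbTE z0).
Qed.

End GraphCrossings.

Section CrossColors.
Variable X : mcBiquandleType.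
Implicit Types (t : ctype) (dk dl : bool) (x : X).

(** The rising strand [k] is below [l] on its left, whereas [l] is below [k] on its right: hence the
    order [Rl Ll]. *)
Lemma cross_under t dk dl (Lk Rk Ll Rl : X) :
  cross t true dk dl Lk Rk Rl Ll <->
  crossing_colors (~~ (dk (+) dl)) t (if dk then Rk else Lk) (if dk then Lk else Rk)
    (if dl then Rl else Ll) (if dl then Ll else Rl).
Proof. by rewrite /cross /flip_colors /crossing_colors; case: dk dl => [] []. Qed.

Lemma cross_over t dk dl (Lk Rk Ll Rl : X) :
  cross t false dk dl Lk Rk Rl Ll <->
  crossing_colors (dk (+) dl) t (if dl then Rl else Ll) (if dl then Ll else Rl)
    (if dk then Rk else Lk) (if dk then Lk else Rk).
Proof. by rewrite /cross /flip_colors /crossing_colors; case: dk dl => [] []. Qed.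

Lemma crossC t u dk dl (a b c d : X) :
  cross t (~~ u) dl dk c d a b <-> cross t u dk dl a b c d.
Proof. by rewrite /cross /flip_colors; case: u dk dl => [] [] []. Qed.
End CrossColors.

Section GraphTangle.
Local Open Scope ring_scope.
Variables (R : realType) (X : mcBiquandleType) (n : nat) (I : finType).
Variables (J : I -> strand R n) (d : I -> bool) (f : I -> R -> R) (D : diagram R n).
Hypothesis J_proper : forall k, proper_strand (J k).
Hypothesis J_disjoint : forall k l, k <> l -> disjoint_strands (J k) (J l).
Hypothesis J_graph : forall k, graph_strand D (J k) (d k) (f k).
Hypothesis D_outside : forall p, (forall k, ~ on_strand (J k) p) -> ~ box (curve D p.1 p.2).
Implicit Types (k l : I) (s e : bool).

(** Points of one strand with the same abscissa coincide, so a crossing in the box involves two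
    different strands. *)
Lemma graph_above p q k : above D p q \/ above D q p -> on_strand (J k) p ->
  exists l x, [/\ k <> l, -1 <= x <= 1, f k x = f l x,
    same_point p (xpoint (J k) (d k) x) & same_point q (xpoint (J l) (d l) x)].
Proof.
move=> h pk; have hbox l r : on_strand (J l) r -> box (curve D r.1 r.2).
  exact: (graph_box (J_proper l) (@J_graph l)).
have [l ql] := box_closed D_outside hbox h pk.
have [x hx px] := on_strand_xpoint (d k) (J_proper k) pk.
have [y hy qy] := on_strand_xpoint (d l) (J_proper l) ql.
have [npq] : crossing (curve D) p q.
  by case: h => /above_crossing // -[nqp e]; split=> // /same_sym.
case: (px) (qy) => e1 [k1 h1] [e2 [k2 h2]]; rewrite e1 e2 h1 h2 !curve_shift.
rewrite (graph_curve (J_proper k) (@J_graph k) hx) (graph_curve (J_proper l) (@J_graph l) hy).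
move=> [xy fxy]; subst y; exists l, x; split=> // kl; subst l.
by apply: npq; exact: same_trans px (same_sym qy).
Qed.

Variable Xp : I -> bool -> R.
Hypothesis Xp_order : forall k, [/\ -1 < Xp k false, Xp k false < Xp k true & Xp k true < 1].

(* Slots follow the orientation of the strand, and positions go from left to
   right: slot [e] of strand k is position [e (+) d k]. *)
Definition gslot1 k := xparam (J k) (d k) (Xp k (d k)).
Definition gslot2 k := xparam (J k) (d k) (Xp k (~~ d k)).

Lemma graph_slot k e :
  slot J gslot1 gslot2 k e = xpoint (J k) (d k) (Xp k (e (+) d k)).
Proof. by rewrite /slot /gslot1 /gslot2 /xpoint; case: e. Qed.

Lemma Xp_range k s : -1 < Xp k s < 1.
Proof. by have [h1 h2 h3] := Xp_order k; case: s; lra. Qed.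

Lemma Xp_inj k s s' : Xp k s = Xp k s' -> s = s'.
Proof.
have [_ h _] := Xp_order k; case: s s' => [] [] // e; move: h; rewrite e ltxx //.
Qed.

Lemma gslot_order k : [/\ (J k).2.1 < gslot1 k, gslot1 k < gslot2 k & gslot2 k < (J k).2.2].
Proof.
have [_ h _] := Xp_order k; have hp := J_proper k.
have i s := xparam_inside (d k) hp (Xp_range k s).
split; first by case/andP: (i (d k)).
  by have := xparam_lt (d k) hp h; rewrite /gslot1 /gslot2; case: (d k).
by case/andP: (i (~~ d k)).
Qed.

Variable tab : I -> bool -> I -> bool -> Prop.
Variable under : I -> I -> bool.

(* [tab k s l s']: at position [s] strand k goes from below strand l to above
   it, and this is position [s'] of strand l. *)
Hypothesis tab_up : forall k s l s', tab k s l s' ->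
  [/\ k <> l, Xp k s = Xp l s',
      near_side false (Xp k s) (fun x => -1 < x < 1 -> f k x < f l x) &
      near_side true (Xp k s) (fun x => -1 < x < 1 -> f l x < f k x)].
Hypothesis tab_meet : forall k l x, k <> l -> -1 <= x <= 1 -> f k x = f l x ->
  exists s s', [/\ x = Xp k s, x = Xp l s' & tab k s l s' \/ tab l s' k s].
Hypothesis tab_all : forall k s, exists l s', tab k s l s' \/ tab l s' k s.
Hypothesis tab_under : forall k l, k <> l ->
  if under k l then strand_above D (J l) (J k) else strand_above D (J k) (J l).

Lemma graph_tangle : tangle J D gslot1 gslot2.
Proof.
split; first exact: gslot_order.
- move=> p k [q h] pk; have [l [x [kl hx fx px _]]] := graph_above h pk.
  have [s [s' [xs _ _]]] := tab_meet kl hx fx; exists (s (+) d k).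
  by rewrite graph_slot -addbA addbb addbF -xs.
- move=> p q k h pk; have [l [x [_ hx _ _ qx]]] := graph_above h pk.
  exists l; apply: on_strand_same (same_sym qx) _; exact: (xpoint_on _ (J_proper l) hx).
Qed.

Let pt k s := xpoint (J k) (d k) (Xp k s).

Lemma tab_crossing k s l s' : tab k s l s' ->
  [/\ if under k l then above D (pt l s') (pt k s) else above D (pt k s) (pt l s'),
     `[< positive D (pt k s) (pt l s') >] = d k (+) d l &
     `[< positive D (pt l s') (pt k s) >] = ~~ (d k (+) d l)].
Proof.
move=> /tab_up[kl e hl hr].
have [cr p1 p2] := graph_crossing (J_proper k) (J_proper l) (J_disjoint kl)
  (@J_graph k) (@J_graph l) (Xp_range k s) hl hr.
have hx : -1 <= Xp k s <= 1 by have := Xp_range k s; lra.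
have cr' : crossing (curve D) (xpoint (J l) (d l) (Xp k s)) (xpoint (J k) (d k) (Xp k s)).
  by case: cr => ns ce; split=> // /same_sym.
rewrite /pt -e; split=> //; have := tab_under kl.
have onk := xpoint_on (d k) (J_proper k) hx; have onl := xpoint_on (d l) (J_proper l) hx.
by case: (under k l) => h; exact: h.
Qed.

Definition strand_type k l := if (J k).1 == (J l).1 then single else multi.

Section Colors.
Variables v0 v1 v2 : I -> X.

Definition left_color k s := if s then v1 k else if d k then v2 k else v0 k.
Definition right_color k s := if s then (if d k then v0 k else v2 k) else v1 k.

Lemma color_beforeE k e : color_before v0 v1 k e =
  if d k then right_color k (e (+) d k) else left_color k (e (+) d k).
Proof. by rewrite /color_before /right_color /left_color; case: (d k) e => [] []. Qed.

Lemma color_afterE k e : color_after v1 v2 k e =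
  if d k then left_color k (e (+) d k) else right_color k (e (+) d k).
Proof. by rewrite /color_after /right_color /left_color; case: (d k) e => [] []. Qed.

(** Replaces colors ordered along the orientation by colors ordered from left to right, the form in
    which both sides of a move can be compared. *)
Lemma graph_local_coloring : local_coloring J D gslot1 gslot2 v0 v1 v2 <->
  forall k s l s', tab k s l s' ->
    cross (strand_type k l) (under k l) (d k) (d l)
      (left_color k s) (right_color k s) (right_color l s') (left_color l s').
Proof.
split=> [[_ h] k s l s' ht|h].
  have [ab p1 p2] := tab_crossing ht.
  have sk := graph_slot k (s (+) d k); have sl := graph_slot l (s' (+) d l).
  rewrite -addbA addbb addbF in sk; rewrite -addbA addbb addbF in sl.
  case u: (under k l) ab => ab.
    have := h l (s' (+) d l) k (s (+) d k); rewrite sk sl => /(_ ab).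
    rewrite !color_beforeE !color_afterE -!addbA !addbb !addbF p2 => hc.
    by apply/cross_under; rewrite /strand_type eq_sym.
  have := h k (s (+) d k) l (s' (+) d l); rewrite sk sl => /(_ ab).
  rewrite !color_beforeE !color_afterE -!addbA !addbb !addbF p1 => hc.
  exact/cross_over.
split=> [k e nc|k e l e' ab].
  case: nc; rewrite graph_slot; have [l [s' [ht|ht]]] := tab_all k (e (+) d k).
    have [+ _ _] := tab_crossing ht.
    by case: (under _ _) => a; exists (pt l s'); [right|left].
  have [+ _ _] := tab_crossing ht.
  by case: (under _ _) => a; exists (pt l s'); [left|right].
rewrite !color_beforeE !color_afterE; move: ab; rewrite !graph_slot.
move: (e (+) d k) (e' (+) d l) => s s' ab.
have hk : -1 <= Xp k s <= 1 by have := Xp_range k s; lra.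
have hl : -1 <= Xp l s' <= 1 by have := Xp_range l s'; lra.
have onk := xpoint_on (d k) (J_proper k) hk.
(* The crossing occurs at a common abscissa; uniqueness of parameters identifies it with the
   positions [s] and [s'], and [tab_meet] finds its entry in [tab]. The wrong height contradicts
   [above_asym]. *)
have [l2 [x [kl hx fx px qx]]] := graph_above (or_introl ab) onk.
have [_ /(can_inj (xparamK (d k) (J_proper k))) xk] := param_uniq J_proper J_disjoint
  (xparam_range (d k) (J_proper k) hk) (xparam_range (d k) (J_proper k) hx) px.
have [ll] := param_uniq J_proper J_disjoint
  (xparam_range (d l) (J_proper l) hl) (xparam_range (d l2) (J_proper l2) hx) qx.
subst l2 => /(can_inj (xparamK (d l) (J_proper l))) xl; subst x.
have [s1 [s1' [e1 e2 htab]]] := tab_meet kl hx fx.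
have {}e1 := Xp_inj e1; have {}e2 := Xp_inj (etrans xl e2); subst s1 s1'.
case: htab => ht; have [hab p1 p2] := tab_crossing ht; have := h _ _ _ _ ht; move: hab.
  case: (under k l) => [/above_asym/(_ ab)//|_ /cross_over].
  by rewrite -p1 /strand_type.
case: (under l k) => [_ /cross_under|/above_asym/(_ ab)//].
by rewrite -p2 /strand_type eq_sym.
Qed.

End Colors.
End GraphTangle.

(** * The second move *)

Section BraidMoves.
Local Open Scope ring_scope.
Variables (R : realType) (X : mcBiquandleType) (S : set (mcEnd X)) (n : nat).
Variables D D' : diagram R n.

Lemma disjoint_strandsC (J K : strand R n) : disjoint_strands J K -> disjoint_strands K J.
Proof. by rewrite /disjoint_strands setIC. Qed.

Lemma reidemeister2_quiver : reidemeister2 D D' ->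
  quiver_iso (coloring_quiver S (existT _ n D)) (coloring_quiver S (existT _ n D')).
Proof.
move=> [J [K [d [e [f [g [f' [g' [a [b [h1 h2 h3 h4 h5]]]]]]]]]]].
case: h1 h2 h4 h5 => [pJ pK dJK] [a1 a2] [Jf Kg fg] [Jf' Kg' [a_lo ab b_hi] fg' hab].
pose JK (k : bool) := if k then K else J; pose de (k : bool) := if k then e else d.
pose F (k : bool) := if k then g else f; pose F' (k : bool) := if k then g' else f'.
have JK_proper k : proper_strand (JK k) by case: k.
have JK_disjoint k l : k <> l -> disjoint_strands (JK k) (JK l).
  by case: k l => [] [] // _; exact: disjoint_strandsC.
have JK_graph k : graph_strand D (JK k) (de k) (F k) by case: k.
have JK_graph' k : graph_strand D' (JK k) (de k) (F' k) by case: k.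
have out p : outside JK p -> ~ (inside_strand J `|` inside_strand K) p.
  by move=> h [/(h false)|/(h true)].
have agree : agree_outside JK D D'.
  by split=> [p /out/a1|p q /out op /out oq]; [|exact: a2].
have D_out p : (forall k, ~ on_strand (JK k) p) -> ~ box (curve D p.1 p.2).
  by move=> h; apply: h3 => -[/(h false)|/(h true)].
have D_out' p : (forall k, ~ on_strand (JK k) p) -> ~ box (curve D' p.1 p.2).
  by move=> h; rewrite agree.1; [exact: D_out|exact: off_outside].
pose Xp (_ : bool) (s : bool) := if s then b else a.
have Xp_order k : [/\ -1 < Xp k false, Xp k false < Xp k true & Xp k true < 1] by [].
have uncut p k : on_strand (JK k) p -> ~ cut_point D p.
  move=> pk [q h]; have [l [x [kl hx fx _ _]]] := graph_above JK_proper JK_graph D_out h pk.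
  by have := fg x hx; move: kl fx; case: k l {pk} => [] [] //= _ ->; rewrite ltxx.
have order := gslot_order de JK_proper Xp_order.
have lc := uncut_local_coloring (X := X) order uncut.
(* With [J] as [false] and [K] as [true], [J] rises above [K] at [a] and [K] above [J] at [b]: at
   position [s] the rising strand is strand [s]. *)
pose tab (k s l s' : bool) := [/\ k = s, l = ~~ s & s' = s].
(* [u] says that [J] is the understrand. *)
have [u tab_under] : exists u, forall k l : bool, k <> l ->
    if k (+) u then strand_above D' (JK l) (JK k) else strand_above D' (JK k) (JK l).
  by case: hab => h; [exists false|exists true] => -[] [].
have tab_up k s l s' : tab k s l s' ->
  [/\ k <> l, Xp k s = Xp l s',
      near_side false (Xp k s) (fun x => -1 < x < 1 -> F' k x < F' l x) &
      near_side true (Xp k s) (fun x => -1 < x < 1 -> F' l x < F' k x)].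
  case=> -> -> ->; case: s => /=; split=> //.
  - exists (b - a); first by rewrite subr_gt0.
    move=> x; rewrite /on_side => hx hx1; have [|_ h _] := fg' x; first by lra.
    by apply: h; lra.
  - exists 1 => // x; rewrite /on_side => hx hx1; have [|_ _ h] := fg' x; first by lra.
    by apply: h; lra.
  - exists 1 => // x; rewrite /on_side => hx hx1; have [|h _ _] := fg' x; first by lra.
    by apply: h; lra.
  - exists (b - a); first by rewrite subr_gt0.
    move=> x; rewrite /on_side => hx hx1; have [|_ h _] := fg' x; first by lra.
    by apply: h; lra.
have tab_meet k l x : k <> l -> -1 <= x <= 1 -> F' k x = F' l x ->
  exists s s', [/\ x = Xp k s, x = Xp l s' & tab k s l s' \/ tab l s' k s].
  move=> kl hx fx; have {}fx : f' x = g' x by move: kl fx; case: (k) (l) => [] [].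
  have [c1 c2 c3] := fg' x hx; rewrite fx ltxx in c1 c2 c3.
  have [s xs] : exists s, x = Xp k s.
    have [xa|xa|xa] := ltgtP x a; [by have := c1 xa| |by exists false].
    have [xb|xb|xb] := ltgtP x b; [|by have := c3 xb|by exists true].
    by have := c2; rewrite xa xb => /(_ isT).
  exists s, s; split=> //; rewrite /tab.
  by case: k l s kl {fx c1 c2 c3 xs} => [] [] [] //= _; [left|right|right|left].
have tab_all k s : exists l s', tab k s l s' \/ tab l s' k s.
  rewrite /tab; case: k s => [] [].
  - by exists false, true; left.
  - by exists false, false; right.
  - by exists true, true; right.
  - by exists true, false; left.
have glc := graph_local_coloring (X := X) JK_proper JK_disjoint JK_graph' D_out'
  Xp_order tab_up tab_meet tab_all tab_under.
pose lo v0 v1 v2 k := left_color (X := X) de v0 v1 v2 k false.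
pose hi v0 v1 v2 k := right_color (X := X) de v0 v1 v2 k true.
pose C := cross (X := X) (strand_type JK false true) u d e.
have rC : regular C by exact: regular_cross.
(* Read from [J] by [crossC], the crossing at [b] is the same relation [C] with the same middle
   colors as the one at [a]. Hence the middle colors determine equal left and right ends. *)
have lc' v0 v1 v2 : local_coloring JK D' (gslot1 JK de Xp) (gslot2 JK de Xp) v0 v1 v2 <->
    C (lo v0 v1 v2 false) (v1 false) (v1 true) (lo v0 v1 v2 true) /\
    C (hi v0 v1 v2 false) (v1 false) (v1 true) (hi v0 v1 v2 true).
  apply: (iff_trans (glc v0 v1 v2)); split=> [h|[h h'] k s l s' [-> -> ->]].
    split; first exact: (h false false true false).
    have := h true true false true (And3 erefl erefl erefl).
    by rewrite /strand_type eq_sym => /crossC.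
  case: s => //=; rewrite /strand_type eq_sym; exact/crossC.
apply: (@tangle_move_quiver _ X _ bool JK JK_proper JK_disjoint S _ _
  (gslot1 JK de Xp) (gslot2 JK de Xp) (gslot1 JK de Xp) (gslot2 JK de Xp)) => //.
- exact: uncut_tangle.
- exact: (graph_tangle JK_proper JK_graph' D_out' Xp_order tab_meet).
- move=> v0 v1 v2 /lc h.
  have [w [w' hw]] := regular_ex false true (v0 false) (v0 true) rC.
  exists (fun k : bool => if k then w' else w); apply/lc'.
  rewrite /lo /hi /left_color /right_color -!(h _).2 -!(h _).1 !if_same.
  by split.
- move=> v0 v1 v2 /lc'[h h']; exists v0; apply/lc.
  have [e1 e2] := regular_uniq (f := true) (g := false) rC h h'.
  (* The left and right end colors are [v0] and [v2] in an order that depends on the direction of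
     the strand. *)
  have e3 k : v0 k = v2 k.
    move: e1 e2; rewrite /lo /hi /left_color /right_color.
    by case: k; case: (de false); case: (de true).
  by move=> k; rewrite -e3.
- by move=> v0 v1 v1' v2 /lc h /lc h' k; rewrite -(h k).1 -(h' k).1.
- move=> v0 v1 v1' v2 /lc'[h _] /lc'[h' _].
  have [e1 e2] := regular_uniq (f := false) (g := true) rC h h'.
  by case.
Qed.

End BraidMoves.

(** * The third move *)

Section BraidRelation.
Local Open Scope ring_scope.
Variables (R : realType) (X : mcBiquandleType) (S : set (mcEnd X)) (n : nat).
Variables D D' : diagram R n.

Definition tri (T : Type) (x0 x1 x2 : T) (k : 'I_3) : T :=
  if val k == 0%N then x0 else if val k == 1%N then x1 else x2.

Lemma ord3P (k : 'I_3) : [\/ k = inord 0, k = inord 1 | k = inord 2].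
Proof.
case: k => -[|[|[|//]]] h; [apply: Or31|apply: Or32|apply: Or33];
  by apply/val_inj; rewrite /= inordK.
Qed.

Lemma triE (T : Type) (x0 x1 x2 : T) :
  [/\ tri x0 x1 x2 (inord 0) = x0, tri x0 x1 x2 (inord 1) = x1 &
      tri x0 x1 x2 (inord 2) = x2].
Proof. by rewrite /tri /= !inordK. Qed.

Lemma cross_once_near (f g : R -> R) c : -1 < c < 1 -> cross_once f g c ->
  near_side false c (fun x => -1 < x < 1 -> f x < g x) /\
  near_side true c (fun x => -1 < x < 1 -> g x < f x).
Proof.
move=> hc h; split; exists 1 => // x; rewrite /on_side => hx hx1.
  by have [|h1 _] := h x; [lra|apply: h1; lra].
by have [|_ h1] := h x; [lra|apply: h1; lra].
Qed.

Lemma cross_once_meet (f g : R -> R) c x : cross_once f g c -> -1 <= x <= 1 ->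
  f x = g x -> x = c.
Proof.
move=> h hx e; have := h x hx; rewrite e ltxx => -[h1 h2].
by have [/h1|/h2|] := ltgtP x c.
Qed.

Lemma reidemeister3_quiver : reidemeister3 D D' ->
  quiver_iso (coloring_quiver S (existT _ n D)) (coloring_quiver S (existT _ n D')).
Proof.
move=> [J [d [f [f' [h]]]]]; set i0 : 'I_3 := inord 0; set i1 : 'I_3 := inord 1.
set i2 : 'I_3 := inord 2.
move=> [[J_proper J_disjoint] [[a1 a2] hbox] hgraph habove [hcr hcr']].
have D_graph k : graph_strand D (J k) (d k) (f k) := (hgraph k).1.
have D_graph' k : graph_strand D' (J k) (d k) (f' k) := (hgraph k).2.
have [n01 n02 n12] : [/\ i0 <> i1, i0 <> i2 & i1 <> i2].
  by rewrite /i0 /i1 /i2; split=> /(congr1 (@nat_of_ord 3)); rewrite !inordK.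
have out p : outside J p -> ~ (\bigcup_k inside_strand (J k)) p.
  by move=> op [k _ /op].
have agree : agree_outside J D D'.
  by split=> [p /out/a1|p q /out op /out oq]; [|exact: a2].
have D_out p : (forall k, ~ on_strand (J k) p) -> ~ box (curve D p.1 p.2).
  by move=> hp; apply: hbox => -[k _ /hp].
have D_out' p : (forall k, ~ on_strand (J k) p) -> ~ box (curve D' p.1 p.2).
  by move=> hp; rewrite agree.1; [exact: D_out|exact: off_outside].
pose under (k l : 'I_3) := (h k < h l)%N.
have h_lt k l : k <> l -> ~~ under k l -> (h l < h k)%N.
  move=> kl; rewrite /under -leqNgt leq_eqVlt => /orP[/eqP/val_inj/perm_inj e|//].
  by case: kl.
have tab_under k l : k <> l ->
    if under k l then strand_above D (J l) (J k) else strand_above D (J k) (J l).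
  move=> kl; case: ifPn => [/habove[]//|/(h_lt _ _ kl)/habove[]//].
have tab_under' k l : k <> l ->
    if under k l then strand_above D' (J l) (J k) else strand_above D' (J k) (J l).
  move=> kl; case: ifPn => [/habove[]//|/(h_lt _ _ kl)/habove[]//].
have [c01 [c02 [c12 [[hc1 hc2 hc3 hc4] [x01 x02 x12]]]]] := hcr.
have [c01' [c02' [c12' [[hc1' hc2' hc3' hc4'] [x01' x02' x12']]]]] := hcr'.
(* Each strand meets the other two: its positions are its two abscissas in increasing order, for
   [c01 < c02 < c12] before the move and [c12' < c02' < c01'] after it. *)
pose Xp (k : 'I_3) (s : bool) := if s then tri c02 c12 c12 k else tri c01 c01 c02 k.
pose Xp' (k : 'I_3) (s : bool) := if s then tri c01' c01' c02' k else tri c02' c12' c12' k.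
(* By [cross_once] the strand of smaller index is always the rising one. *)
pose tab (k : 'I_3) (s : bool) (l : 'I_3) (s' : bool) :=
  [\/ [/\ k = i0, s = false, l = i1 & s' = false],
      [/\ k = i0, s = true, l = i2 & s' = false] |
      [/\ k = i1, s = true, l = i2 & s' = true]].
pose tab' (k : 'I_3) (s : bool) (l : 'I_3) (s' : bool) :=
  [\/ [/\ k = i0, s = true, l = i1 & s' = true],
      [/\ k = i0, s = false, l = i2 & s' = true] |
      [/\ k = i1, s = false, l = i2 & s' = false]].
have XpE : [/\ Xp i0 false = c01, Xp i0 true = c02, Xp i1 false = c01 &
    [/\ Xp i1 true = c12, Xp i2 false = c02 & Xp i2 true = c12]].
  rewrite /Xp; have [-> -> ->] := triE c02 c12 c12.
  by have [-> -> ->] := triE c01 c01 c02.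
have XpE' : [/\ Xp' i0 false = c02', Xp' i0 true = c01', Xp' i1 false = c12' &
    [/\ Xp' i1 true = c01', Xp' i2 false = c12' & Xp' i2 true = c02']].
  rewrite /Xp'; have [-> -> ->] := triE c01' c01' c02'.
  by have [-> -> ->] := triE c02' c12' c12'.
case: XpE XpE' => [X0 X0' X1 [X1' X2 X2']] [Y0 Y0' Y1 [Y1' Y2 Y2']].
have Xp_order k : [/\ -1 < Xp k false, Xp k false < Xp k true & Xp k true < 1].
  by case: (ord3P k) => ->; rewrite -/i0 -/i1 -/i2 ?X0 ?X0' ?X1 ?X1' ?X2 ?X2'; split; lra.
have Xp_order' k : [/\ -1 < Xp' k false, Xp' k false < Xp' k true & Xp' k true < 1].
  by case: (ord3P k) => ->; rewrite -/i0 -/i1 -/i2 ?Y0 ?Y0' ?Y1 ?Y1' ?Y2 ?Y2'; split; lra.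
have tab_up k s l s' : tab k s l s' ->
  [/\ k <> l, Xp k s = Xp l s',
      near_side false (Xp k s) (fun x => -1 < x < 1 -> f k x < f l x) &
      near_side true (Xp k s) (fun x => -1 < x < 1 -> f l x < f k x)].
  by case=> -[-> -> -> ->]; rewrite ?X0 ?X0' ?X1 ?X1' ?X2 ?X2'; split=> //;
    apply cross_once_near => //; lra.
have tab_up' k s l s' : tab' k s l s' ->
  [/\ k <> l, Xp' k s = Xp' l s',
      near_side false (Xp' k s) (fun x => -1 < x < 1 -> f' k x < f' l x) &
      near_side true (Xp' k s) (fun x => -1 < x < 1 -> f' l x < f' k x)].
  by case=> -[-> -> -> ->]; rewrite ?Y0 ?Y0' ?Y1 ?Y1' ?Y2 ?Y2'; split=> //;
    apply cross_once_near => //; lra.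
have tab_meet k l x : k <> l -> -1 <= x <= 1 -> f k x = f l x ->
  exists s s', [/\ x = Xp k s, x = Xp l s' & tab k s l s' \/ tab l s' k s].
  move=> kl hx fx; have m01 := cross_once_meet x01 hx.
  have m02 := cross_once_meet x02 hx; have m12 := cross_once_meet x12 hx.
  move: kl fx; case: (ord3P k) (ord3P l) => -> [] -> //= _ fx.
  - by exists false, false; rewrite X0 X1 -(m01 fx); split=> //; left; apply: Or31.
  - by exists true, false; rewrite X0' X2 -(m02 fx); split=> //; left; apply: Or32.
  - by exists false, false; rewrite X0 X1 -(m01 (esym fx)); split=> //; right; apply: Or31.
  - by exists true, true; rewrite X1' X2' -(m12 fx); split=> //; left; apply: Or33.
  - by exists false, true; rewrite X0' X2 -(m02 (esym fx)); split=> //; right; apply: Or32.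
  - by exists true, true; rewrite X1' X2' -(m12 (esym fx)); split=> //; right; apply: Or33.
have tab_meet' k l x : k <> l -> -1 <= x <= 1 -> f' k x = f' l x ->
  exists s s', [/\ x = Xp' k s, x = Xp' l s' & tab' k s l s' \/ tab' l s' k s].
  move=> kl hx fx; have m01 := cross_once_meet x01' hx.
  have m02 := cross_once_meet x02' hx; have m12 := cross_once_meet x12' hx.
  move: kl fx; case: (ord3P k) (ord3P l) => -> [] -> //= _ fx.
  - by exists true, true; rewrite Y0' Y1' -(m01 fx); split=> //; left; apply: Or31.
  - by exists false, true; rewrite Y0 Y2' -(m02 fx); split=> //; left; apply: Or32.
  - by exists true, true; rewrite Y0' Y1' -(m01 (esym fx)); split=> //; right; apply: Or31.
  - by exists false, false; rewrite Y1 Y2 -(m12 fx); split=> //; left; apply: Or33.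
  - by exists true, false; rewrite Y0 Y2' -(m02 (esym fx)); split=> //; right; apply: Or32.
  - by exists false, false; rewrite Y1 Y2 -(m12 (esym fx)); split=> //; right; apply: Or33.
have tab_all k s : exists l s', tab k s l s' \/ tab l s' k s.
  case: (ord3P k) s => -> [].
  - by exists i2, false; left; apply: Or32.
  - by exists i1, false; left; apply: Or31.
  - by exists i2, true; left; apply: Or33.
  - by exists i0, false; right; apply: Or31.
  - by exists i1, true; right; apply: Or33.
  - by exists i0, true; right; apply: Or32.
have tab_all' k s : exists l s', tab' k s l s' \/ tab' l s' k s.
  case: (ord3P k) s => -> [].
  - by exists i1, true; left; apply: Or31.
  - by exists i2, true; left; apply: Or32.
  - by exists i0, true; right; apply: Or31.
  - by exists i2, false; left; apply: Or33.
  - by exists i0, false; right; apply: Or32.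
  - by exists i1, false; right; apply: Or33.
have glc := graph_local_coloring (X := X) J_proper J_disjoint D_graph D_out
  Xp_order tab_up tab_meet tab_all tab_under.
have glc' := graph_local_coloring (X := X) J_proper J_disjoint D_graph' D_out'
  Xp_order' tab_up' tab_meet' tab_all' tab_under'.
pose lo v0 v1 v2 k := left_color (X := X) d v0 v1 v2 k false.
pose hi v0 v1 v2 k := right_color (X := X) d v0 v1 v2 k true.
pose C k l := cross (X := X) (strand_type J k l) (under k l) (d k) (d l).
have rC k l : regular (C k l) by exact: regular_cross.
have lc v0 v1 v2 : local_coloring J D (gslot1 J d Xp) (gslot2 J d Xp) v0 v1 v2 <->
    braid_left (C i0 i1) (C i0 i2) (C i1 i2) (lo v0 v1 v2 i0) (lo v0 v1 v2 i1)
      (lo v0 v1 v2 i2) (v1 i0) (v1 i1) (v1 i2)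
      (hi v0 v1 v2 i0) (hi v0 v1 v2 i1) (hi v0 v1 v2 i2).
  apply: (iff_trans (glc v0 v1 v2)); split=> [hl|[b01 b02 b12] k s l s'].
    split; [apply: (hl i0 false i1 false)|apply: (hl i0 true i2 false)
      |apply: (hl i1 true i2 true)]; [exact: Or31|exact: Or32|exact: Or33].
  by case=> -[-> -> -> ->].
have lc' v0 v1 v2 : local_coloring J D' (gslot1 J d Xp') (gslot2 J d Xp') v0 v1 v2 <->
    braid_right (C i0 i1) (C i0 i2) (C i1 i2) (lo v0 v1 v2 i0) (lo v0 v1 v2 i1)
      (lo v0 v1 v2 i2) (v1 i0) (v1 i1) (v1 i2)
      (hi v0 v1 v2 i0) (hi v0 v1 v2 i1) (hi v0 v1 v2 i2).
  apply: (iff_trans (glc' v0 v1 v2)); split=> [hl|[b12 b02 b01] k s l s'].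
    split; [apply: (hl i1 false i2 false)|apply: (hl i0 false i2 true)
      |apply: (hl i0 true i1 true)]; [exact: Or33|exact: Or32|exact: Or31].
  by case=> -[-> -> -> ->].
have yb : braided (C i0 i1) (C i0 i2) (C i1 i2).
  (* Transitivity of equality of components gives the admissible triples, that of the heights the
     acyclic patterns. *)
  apply: braided_cross; rewrite /strand_type;
    try (by apply: mc_tripleP => /eqP-> // /eqP->); rewrite /under.
    exact: ltn_trans.
  by rewrite -!leqNgt => q1 q2; exact: leq_trans q2 q1.
apply: (@tangle_move_quiver _ X _ _ J J_proper J_disjoint S _ _
  (gslot1 J d Xp) (gslot2 J d Xp) (gslot1 J d Xp') (gslot2 J d Xp')) => //.
- exact: (graph_tangle J_proper D_graph D_out Xp_order tab_meet).
- exact: (graph_tangle J_proper D_graph' D_out' Xp_order' tab_meet').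
- move=> v0 v1 v2 /lc/yb[m0 [m1 [m2 hm]]]; exists (tri m0 m1 m2); apply/lc'.
  by have [-> -> ->] := triE m0 m1 m2.
- move=> v0 v1 v2 /lc'/(braided_sym (rC _ _) (rC _ _) (rC _ _) yb)[m0 [m1 [m2 hm]]].
  by exists (tri m0 m1 m2); apply/lc; have [-> -> ->] := triE m0 m1 m2.
- move=> v0 v1 v1' v2 /lc h1 /lc h2 k.
  have [e0 e1 e2] := braid_left_inj (rC _ _) (rC _ _) h1 h2.
  by case: (ord3P k) => ->.
- move=> v0 v1 v1' v2 /lc' h1 /lc' h2 k.
  have [[e0 e1 e2] _] := braid_right_inj (rC _ _) (rC _ _) (rC _ _) h1 h2.
  by case: (ord3P k) => ->.
Qed.

End BraidRelation.

(** * From single moves to equivalence of diagrams *)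

Lemma classical_move_quiver (R : realType) (X : mcBiquandleType)
    (fX : finite_set [set: X]) (S : set (mcEnd X)) n (D D' : diagram R n) :
  classical_move D D' ->
  quiver_iso (coloring_quiver S (existT _ n D)) (coloring_quiver S (existT _ n D')).
Proof.
case.
- exact: reparametrization_quiver.
- exact: planar_isotopy_quiver.
- exact: reidemeister1_quiver.
- exact: reidemeister2_quiver.
- exact: reidemeister3_quiver.
Qed.

Lemma clos_rst_quiver (R : realType) (X : mcBiquandleType) (S : set (mcEnd X))
    (step : link_diagram R -> link_diagram R -> Prop) :
  (forall L L', step L L' -> quiver_iso (coloring_quiver S L) (coloring_quiver S L')) ->
  forall L L', Relation_Operators.clos_refl_sym_trans _ step L L' ->
  quiver_iso (coloring_quiver S L) (coloring_quiver S L').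
Proof.
move=> h L L'; elim=> [K K' /h//|K|K K' _|K K' K'' _ h1 _ h2].
- exact: quiver_iso_refl.
- exact: quiver_iso_sym.
- exact: quiver_iso_trans h1 h2.
Qed.

Theorem theorem3 (R : realType) (X : mcBiquandleType)
    (hX : finite_set [set: X]) (S : set (mcEnd X)) (L L' : link_diagram R) :
  same_link L L' -> quiver_iso (coloring_quiver S L) (coloring_quiver S L').
Proof.
case=> [[_ _]|]; apply: clos_rst_quiver => K K' [] n D D'.
- by move=> _ _; exact: classical_move_quiver.
- exact: classical_move_quiver.
- exact: detour_quiver.
Qed.
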